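(* Fix $p \geq 2$ and consider the $p$-spin Curie–Weiss model, i.e. the $p$-tensor Ising model $\mathbb{P}_\beta$ with interaction tensor $\boldsymbol J_N = ((J_{i_1 \ldots i_p}))_{1 \leq i_1, \ldots, i_p \leq N}$, where $J_{i_1 \ldots i_p} = \frac{1}{N^{p-1}}$ for all $1 \leq i_1, \ldots, i_p \leq N$. Let $\boldsymbol X\sim\mathbb{P}_\beta$ and let $\hat\beta_N(\boldsymbol X)$ be the maximum pseudo-likelihood (MPL) estimate. Then for every $\beta > \beta_{\mathrm{CW}}^*(p)$, as $N \rightarrow \infty$, $$\sqrt{N}\big(\hat{\beta}_N(\boldsymbol X) -\beta\big) \xrightarrow{D} N\left(0, -\frac{g''(m_* )}{p^2m_*^{2p-2}}\right),$$ where $g(t) := \beta t^p - I(t)$ for $t \in [-1, 1]$, and $m_*=m_*(\beta, p)$ is the unique positive global maximizer of $g$.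
   Context: $I(t)=\frac12\{(1+t)\log(1+t)+(1-t)\log(1-t)\}$ for $t\in[-1,1]$ ($0\log 0=0$). The Curie–Weiss threshold is $\beta_{\mathrm{CW}}^*(p)=\sup\{\beta\geq0:\sup_{t\in[0,1]}\{\beta t^p-I(t)\}=0\}$. The $p$-tensor Ising model with interaction tensor $\boldsymbol J_N$ and parameter $\beta\ge0$ is the distribution on $\{-1,1\}^N$ given by $\mathbb{P}_{\beta}(\boldsymbol x)=\frac{1}{2^NZ_N(\beta)}e^{\beta H_N(\boldsymbol x)}$, with $H_N(\boldsymbol x)=\sum_{1\leq i_1,\ldots,i_p\leq N}J_{i_1\ldots i_p}x_{i_1}\cdots x_{i_p}$ and $Z_N(\beta)=2^{-N}\sum_{\boldsymbol x}e^{\beta H_N(\boldsymbol x)}$. In the Curie–Weiss model (diagonal entries included) $H_N(\boldsymbol x)=N\bar x_N^{\,p}$ with $\bar x_N=\frac1N\sum_i x_i$. With $m_i(\boldsymbol x)=\sum_{1\leq i_2,\ldots,i_p\leq N}J_{ii_2\ldots i_p}x_{i_2}\cdots x_{i_p}$ (here $m_i(\boldsymbol x)=\bar x_N^{\,p-1}$), the MPL estimate is $\hat\beta_N(\boldsymbol X)=\inf\{b\geq0:H_N(\boldsymbol X)=\sum_{i=1}^Nm_i(\boldsymbol X)\tanh(p\,b\,m_i(\boldsymbol X))\}$, with $\inf\emptyset=+\infty$. $\xrightarrow{D}$ denotes convergence in distribution (under $\mathbb{P}_\beta$). *)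

(* Defs.v *)
From HB Require Import structures.
From mathcomp Require Import all_boot all_order all_algebra.
From mathcomp Require Import all_classical all_reals all_analysis.
Set Implicit Arguments.
Unset Strict Implicit.
Unset Printing Implicit Defensive.
Import Order.TTheory GRing.Theory Num.Theory.
Import numFieldNormedType.Exports.
Local Open Scope classical_set_scope.
Local Open Scope ring_scope.

(* The convention 0 log 0 = 0 holds since 0 * _ = 0. Only the values on
   [-1, 1] are meaningful. *)
Definition rate {R : realType} (t : R) : R :=
  2^-1 * ((1 + t) * ln (1 + t) + (1 - t) * ln (1 - t)).

Definition cw_g {R : realType} (p : nat) (beta t : R) : R :=
  beta * t ^+ p - rate t.

Definition cw_threshold (R : realType) (p : nat) : R :=
  sup [set beta : R | 0 <= beta /\
    sup [set cw_g p beta t | t in [set t : R | 0 <= t <= 1]] = 0].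

Definition pos_global_maximizer {R : realType} (p : nat) (beta m : R) : Prop :=
  0 < m <= 1 /\ forall t : R, -1 <= t <= 1 -> cw_g p beta t <= cw_g p beta m.

Definition tanh {R : realType} (y : R) : R :=
  (expR y - expR (- y)) / (expR y + expR (- y)).

(* {-1, 1}^N is encoded by boolean functions; see [spin]. *)
Definition config (N : nat) : finType := {ffun 'I_N -> bool}.

Definition spin {R : realType} (N : nat) (x : config N) (i : 'I_N) : R :=
  if x i then 1 else -1.

Section TensorIsing.
Context {R : realType} {p N : nat} (J : p.-tuple 'I_N -> R).

Definition hamiltonian (x : config N) : R :=
  \sum_(s : p.-tuple 'I_N) J s * \prod_(i <- s) spin x i.

Definition partition_fun (beta : R) : R :=
  (2 ^+ N)^-1 * \sum_(x : config N) expR (beta * hamiltonian x).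

Definition ising_pmf (beta : R) (x : config N) : R :=
  (2 ^+ N * partition_fun beta)^-1 * expR (beta * hamiltonian x).

Definition ising_prob (beta : R) (A : pred (config N)) : R :=
  \sum_(x : config N | A x) ising_pmf beta x.

(* The sum ranges over the tuples s = (i, i_2, ..., i_p). *)
Definition local_field (i : 'I_N) (x : config N) : R :=
  \sum_(s : p.-tuple 'I_N | ohead s == Some i)
    J s * \prod_(j <- behead s) spin x j.

(* [ereal_inf set0 = +oo]. *)
Definition mpl_estimate (x : config N) : \bar R :=
  ereal_inf [set b%:E | b in [set b : R | 0 <= b /\
    hamiltonian x =
      \sum_(i < N) local_field i x * tanh (p%:R * b * local_field i x)]].

End TensorIsing.

Definition cw_tensor (R : realType) (p N : nat) (s : p.-tuple 'I_N) : R :=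
  (N%:R ^+ p.-1)^-1.

(* Convergence in distribution of the random variables Y n, defined on finite
   probability spaces (T n, P n), to the law mu: the distribution functions
   converge at the continuity points of the one of mu. The Y n may be
   infinite; as mu is a probability on R, the mass at -oo and +oo vanishes in
   the limit. *)
Definition cvg_in_distribution {R : realType} (T : nat -> finType)
    (P : forall n, pred (T n) -> R) (Y : forall n, T n -> \bar R)
    (mu : probability (measurableTypeR R) R) : Prop :=
  forall t : R,
    {for t, continuous (fun u : R => mu [set v : R | v <= u])} ->
    (P n (fun x => (Y n x <= t%:E)%E))%:E @[n --> \oo]
      --> mu [set v : R | v <= t].

(* Main.v *)
Require Import Defs.
From mathcomp Require Import all_boot all_order all_algebra.
From mathcomp Require Import all_classical all_reals all_analysis.
From mathcomp Require Import measurable_realfun.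
From mathcomp Require Import ring lra.
Import Order.TTheory GRing.Theory Num.Theory.
Import numFieldNormedType.Exports.
Local Open Scope classical_set_scope.
Local Open Scope ring_scope.
Set Implicit Arguments.
Unset Strict Implicit.
Unset Printing Implicit Defensive.

(** Write [g = cw_g p beta], and let [xbar] be the mean of the spins.

    Beyond the threshold [g] takes a positive value on [[0, 1]]
    ([cw_threshold_gt]), so it has a positive maximizer [m], and [m < 1] because
    the slope of [g] tends to [-oo] at [1]. The second derivative of [g] has the
    sign of [C * t ^ (p - 2) * (1 - t ^ 2) - 1], where the product is unimodal,
    so it stays negative once it has gone from positive to negative
    ([cw_g2_quasiconcave]); this makes [m] unique and non-degenerate, and [g]
    lies below [g m - c * (x - m) ^ 2] on [[0, 1]] ([cw_g_quadratic_bound]).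

    The Hamiltonian is [N * xbar ^ p] and all local fields equal
    [xbar ^ (p - 1)]. Hence the law of the estimate is a binomial sum
    ([ising_prob_levels]), and for [0 < xbar < 1] the estimate is the solution
    [b = field_inverse p xbar] of [xbar = tanh (p * b * xbar ^ (p - 1))]
    ([level_estimateE]). This function takes the value [beta] at [m], where its
    derivative is [slope = - g'' m / (p * m ^ (p - 1))].

    By Stirling's formula the weight of the level [xbar = x] is, up to a factor
    common to all levels,
    [2 / sqrt N * exp (N * (g x - g m)) / sqrt (1 - x ^ 2)], times a convergent
    factor ([cw_weightE]). In the variable [y = sqrt N * slope * (x - m)] these
    weights are dominated by a Gaussian ([cw_weight_bound]) and converge to a
    multiple of the density of the limit law ([cw_weight_cvg]). Seen as
    integrals of step functions, the sums over the levels therefore converge by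
    dominated convergence ([cvg_lattice_sum]). The event
    [sqrt N * (field_inverse p x - beta) <= t] is carried along as an indicator:
    by the delta method it becomes [y <= t] pointwise, except at [y = t], so that
    no separate limit theorem for [xbar] is needed ([cvg_level_sum]). Constants
    such as the one in Stirling's formula cancel because a probability is a
    quotient of two such sums.

    Levels with [xbar <= 0] are dealt with by parity. For even [p] the negative
    levels mirror the positive ones, as both the weights and the estimate are
    invariant under [xbar -> - xbar]. The level [0], and for odd [p] all these
    levels together, have weight at most [2 ^ N], which is negligible against
    [2 ^ N * exp (N * g m)] ([remainder_bounds]). *)

(** * The rate function and the free energy *)

Section FreeEnergy.
Context {R : realType}.
Implicit Types t x beta : R.

Definition atanh t : R := 2^-1 * (ln (1 + t) - ln (1 - t)).

Lemma is_derive_ln1D t : -1 < t -> is_derive t 1 (fun u => ln (1 + u)) (1 + t)^-1.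
Proof.
move=> t1; have t0 : 0 < 1 + t by lra.
have d1 : is_derive t 1 (fun u : R => 1 + u) 1.
  by apply: (@is_derive_eq _ _ _ ((cst 1 : R -> R) + id)); rewrite add0r.
apply: (@is_derive_eq _ _ _ ((@ln R) \o (fun u => 1 + u)) _ _ _ ((1 + t)^-1 * 1)).
  by apply: is_derive1_comp; exact: is_derive1_ln.
by rewrite mulr1.
Qed.

Lemma is_derive_ln1B t : t < 1 -> is_derive t 1 (fun u => ln (1 - u)) (- (1 - t)^-1).
Proof.
move=> t1; have t0 : 0 < 1 - t by lra.
have d1 : is_derive t 1 (fun u : R => 1 - u) (-1).
  by apply: (@is_derive_eq _ _ _ ((cst 1 : R -> R) - id)); rewrite sub0r.
apply: (@is_derive_eq _ _ _ ((@ln R) \o (fun u => 1 - u)) _ _ _ ((1 - t)^-1 * -1)).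
  by apply: is_derive1_comp; exact: is_derive1_ln.
by rewrite mulrN1.
Qed.

Lemma is_derive_atanh t : -1 < t < 1 -> is_derive t 1 atanh (1 - t ^+ 2)^-1.
Proof.
move=> /andP[tN1 t1]; have := is_derive_ln1B t1; have := is_derive_ln1D tN1.
move=> dD dB.
apply: (@is_derive_eq _ _ _
  (2^-1 \*: ((fun u => ln (1 + u)) - (fun u => ln (1 - u))))).
rewrite /GRing.scale/=; field.
by apply/and3P; split; apply/lt0r_neq0; nra.
Qed.

Lemma is_derive_rate t : -1 < t < 1 -> is_derive t 1 rate (atanh t).
Proof.
move=> /andP[tN1 t1]; have := is_derive_ln1B t1; have := is_derive_ln1D tN1.
move=> dD dB.
have d1 : is_derive t 1 (fun u : R => 1 + u) 1.
  by apply: (@is_derive_eq _ _ _ ((cst 1 : R -> R) + id)); rewrite add0r.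
have d2 : is_derive t 1 (fun u : R => 1 - u) (-1).
  by apply: (@is_derive_eq _ _ _ ((cst 1 : R -> R) - id)); rewrite sub0r.
have := @is_deriveZ _ _ _ _ 2^-1 _ _ _
  (is_deriveD (is_deriveM d1 dD) (is_deriveM d2 dB)).
move=> /is_derive_eq; apply.
rewrite /GRing.scale/= /atanh; field.
by apply/andP; split; apply/lt0r_neq0; lra.
Qed.

Section Derivatives.
Variables (p : nat) (beta : R).

Definition cw_g1 t : R := p%:R * beta * t ^+ p.-1 - atanh t.
Definition cw_g2 t : R :=
  p%:R * p.-1%:R * beta * t ^+ p.-2 - (1 - t ^+ 2)^-1.

Lemma is_derive_pow n (c t : R) :
  is_derive t 1 (fun u => c * u ^+ n) (c * n%:R * t ^+ n.-1).
Proof.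
rewrite (_ : (fun u => _) = c \*: (id ^+ n)); last first.
  by apply/funext => u /=; rewrite exprfctE.
apply: is_derive_eq; rewrite /GRing.scale/=; ring.
Qed.

Lemma is_derive_cw_g t : -1 < t < 1 -> is_derive t 1 (cw_g p beta) (cw_g1 t).
Proof.
move=> t1; have := is_derive_rate t1; have := is_derive_pow p beta t => dp dr.
apply: (@is_derive_eq _ _ _ ((fun u => beta * u ^+ p) - rate)).
by rewrite /cw_g1; ring.
Qed.

Lemma is_derive_cw_g1 t : -1 < t < 1 -> is_derive t 1 cw_g1 (cw_g2 t).
Proof.
move=> t1; have := is_derive_atanh t1.
have := is_derive_pow p.-1 (p%:R * beta) t => dp dr.
apply: (@is_derive_eq _ _ _ ((fun u => p%:R * beta * u ^+ p.-1) - atanh)).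
by rewrite /cw_g2; ring.
Qed.

Lemma derive1n2_cw_g t : -1 < t < 1 -> derive1n 2 (cw_g p beta) t = cw_g2 t.
Proof.
move=> /[dup] t1 /andP[tN1 tlt1].
have -> : derive1n 2 (cw_g p beta) t = (derive1 (derive1 (cw_g p beta))) t by [].
rewrite derive1E -(@near_eq_derive _ _ _ cw_g1) ?oner_eq0//.
  by have := is_derive_cw_g1 t1 => d; rewrite derive_val.
near=> u; have u1 : -1 < u < 1.
  near: u; have := @near_in_itvoo R (-1) 1 t.
  by rewrite in_itv/= => /(_ t1); apply: filterS => u; rewrite in_itv.
by have := is_derive_cw_g u1 => d; rewrite derive1E derive_val.
Unshelve. all: by end_near. Qed.

End Derivatives.

End FreeEnergy.

Section FreeEnergyMaximizer.
Context {R : realType}.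
Implicit Types t x : R.

(** At [0] this is the convention [0 log 0 = 0]: the bound
    [|x ln x| <= 2 sqrt |x|] comes from [ln s^-1 <= s^-1] for [s = sqrt x]. *)
Lemma continuous_mul_ln : continuous (fun x : R => x * ln x).
Proof.
move=> x; have [x0|x0|x0] := ltgtP x 0.
- have : (fun=> 0 : R) y @[y --> x] --> x * ln x.
    by rewrite ln0 ?mulr0; [exact: cvg_cst|exact: ltW].
  apply: cvg_trans; apply: near_eq_cvg; near=> y.
  rewrite ln0 ?mulr0//; apply: ltW.
  by near: y; exact: lt_nbhsl.
- by apply: cvgM; [exact: cvg_id|exact: continuous_ln].
- have bnd (y : R) : y < 1 -> `|y * ln y| <= 2 * Num.sqrt `|y|.
    move=> y1; have [y0|y0] := leP y 0.
      by rewrite ln0 ?mulr0 ?normr0 ?mulr_ge0 ?sqrtr_ge0.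
    set s := Num.sqrt y; have s0 : 0 < s by rewrite sqrtr_gt0.
    have ys : y = s ^+ 2 by rewrite sqr_sqrtr// ltW.
    rewrite (gtr0_norm y0) -/s ler0_norm; last first.
      by rewrite mulr_ge0_le0 ?(ltW y0)// ln_le0// ltW.
    have := @ln_sublinear R s^-1; rewrite invr_gt0 => /(_ s0).
    rewrite lnV ?posrE// => /ltW sl.
    rewrite ys lnXn// expr2 mulr2n.
    have : s * s * (- ln s) <= s * s * s^-1 by rewrite ler_pM2l ?mulr_gt0.
    rewrite mulfK ?gt_eqF//; lra.
  rewrite x0 /continuous_at /= mul0r; apply/cvgr0Pnorm_lt => e e0.
  have : (fun y : R => 2 * Num.sqrt `|y|) y @[y --> (0 : R)] --> (2 * 0 : R).
    apply: cvgM; first exact: cvg_cst.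
    rewrite -[X in _ --> X]sqrtr0 -[X in Num.sqrt X](@normr0 _ R).
    apply: (@continuous_comp _ _ _ (fun y : R => `|y|) Num.sqrt).
      exact: norm_continuous.
    exact: sqrt_continuous.
  rewrite mulr0 => /cvgr0Pnorm_lt /(_ _ e0) h; near=> y.
  apply: le_lt_trans (bnd y _) _.
    by near: y; apply: lt_nbhsl; exact: ltr01.
  apply: le_lt_trans (ler_norm _) _; near: y; exact: h.
Unshelve. all: by end_near. Qed.

Lemma continuous_rate : continuous (@rate R).
Proof.
move=> x; apply: cvgMl_tmp; apply: cvgD.
  apply: (@continuous_comp _ _ _ (fun u : R => 1 + u) (fun v => v * ln v)).
    by apply: cvgD; [exact: cvg_cst|exact: cvg_id].
  exact: continuous_mul_ln.
apply: (@continuous_comp _ _ _ (fun u : R => 1 - u) (fun v => v * ln v)).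
  by apply: cvgB; [exact: cvg_cst|exact: cvg_id].
exact: continuous_mul_ln.
Qed.

Lemma continuous_cw_g p (beta : R) : continuous (cw_g p beta).
Proof.
move=> x; apply: cvgB; last exact: continuous_rate.
by apply: cvgMl_tmp; exact: exprn_continuous.
Qed.

Lemma rate0 : rate 0 = 0 :> R.
Proof. by rewrite /rate subr0 addr0 ln1 mulr0 addr0 mulr0. Qed.

Lemma rate1 : rate 1 = ln 2 :> R.
Proof. by rewrite /rate subrr mul0r addr0; have := @natr1 R 1 => ->; field. Qed.

Lemma rateN t : rate (- t) = rate t.
Proof. by rewrite /rate opprK addrC. Qed.

Lemma atanh0 : atanh 0 = 0 :> R.
Proof. by rewrite /atanh addr0 subr0 subrr mulr0. Qed.

Lemma atanh_ge0 t : 0 <= t < 1 -> 0 <= atanh t.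
Proof.
move=> /andP[t0 t1]; rewrite /atanh mulr_ge0 ?invr_ge0// subr_ge0.
by rewrite ler_ln ?posrE; lra.
Qed.

Lemma rate_ge0 t : 0 <= t <= 1 -> 0 <= rate t.
Proof.
move=> /andP[t0 t1].
have [||c] := @MVT_segment R rate atanh 0 t t0.
- move=> x; rewrite in_itv/= => /andP[x0 xt].
  by apply: is_derive_rate; lra.
- by apply: continuous_subspaceT => x; exact: continuous_rate.
rewrite in_itv/= rate0 => /andP[c0 ct] E.
have -> : rate t = atanh c * t by lra.
rewrite mulr_ge0//.
have [ct1|c1] := ltP c 1; first by apply: atanh_ge0; rewrite c0.
(* The formula for [atanh 1] contains [ln 0], whose default value is [0]. *)
have -> : c = 1 by lra.
by rewrite /atanh subrr (@ln0 R 0)// subr0 mulr_ge0 ?invr_ge0// ln_ge0//; lra.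
Qed.

Section Threshold.
Variables (p : nat) (hp : (2 <= p)%N) (beta : R).
Local Notation g := (cw_g p beta).
Local Notation g1 := (cw_g1 p beta).
Local Notation g2 := (cw_g2 p beta).

Lemma cw_g0 : g 0 = 0.
Proof. by rewrite /cw_g rate0 subr0 expr0n; case: p hp => // n _; rewrite mulr0. Qed.

Lemma cw_g_le_abs t : 0 <= beta -> g t <= g `|t|.
Proof.
move=> b0; rewrite /cw_g -normrX lerB//.
  by apply: ler_wpM2l => //; exact: ler_norm.
by case: (ger0P t) => _; rewrite ?rateN.
Qed.

(** The set whose supremum is the threshold is bounded by [ln 2], since
    [cw_g p b 1 = b - ln 2]; so a [beta] beyond the threshold lies outside this
    set, and as [cw_g p beta 0 = 0] the free energy takes a positive value. *)
Lemma cw_threshold_gt : cw_threshold R p < beta ->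
  0 < beta /\ exists2 t, 0 <= t <= 1 & 0 < g t.
Proof.
rewrite /cw_threshold; set S := [set b | _] => Sb.
have zero b : [set cw_g p b t | t in [set t : R | 0 <= t <= 1]] 0.
  exists 0; first by rewrite /= lexx ler01.
  by rewrite /cw_g rate0 subr0 expr0n; case: p hp => // n _; rewrite mulr0.
have ubd b : 0 <= b ->
    has_ubound [set cw_g p b t | t in [set t : R | 0 <= t <= 1]].
  move=> b0; exists b => _ [t /= t01 <-]; rewrite /cw_g.
  have := rate_ge0 t01; move: t01 => /andP[t0 t1] rt.
  rewrite lerBlDr ler_wpDr// -[leRHS]mulr1 ler_wpM2l// exprn_ile1//.
have S0 : S 0.
  split => //; apply/le_anti/andP; split.
    apply: ge_sup; first by exists 0; exact: zero.
    move=> _ [t /= t01 <-]; rewrite /cw_g mul0r sub0r oppr_le0; exact: rate_ge0.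
  by apply: ub_le_sup; [exact: ubd|exact: zero].
have Subd : has_ubound S.
  exists (ln 2) => b [b0 sb]; have : cw_g p b 1 <= 0.
    by rewrite -sb; apply: ub_le_sup; [exact: ubd|exists 1 => //=; rewrite ler01 lexx].
  by rewrite /cw_g expr1n mulr1 rate1 subr_le0.
have supS0 : 0 <= sup S by exact: ub_le_sup.
have b0 : 0 < beta by exact: le_lt_trans Sb.
split => //; apply: contrapT => H.
have : S beta.
  split; first exact: ltW.
  apply/le_anti/andP; split.
    apply: ge_sup; first by exists 0; exact: zero.
    move=> _ [t /= t01 <-]; rewrite leNgt; apply/negP => gt; apply: H.
    by exists t.
  by apply: ub_le_sup; [apply: ubd; exact: ltW|exact: zero].
by move=> /(ub_le_sup Subd); rewrite leNgt Sb.
Qed.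

Lemma cw_g_MVT a b : -1 <= a -> a < b -> b <= 1 ->
  exists2 c, a < c < b & g b - g a = g1 c * (b - a).
Proof.
move=> a1 ab b1.
have [||c] := @MVT R g g1 a b ab.
- move=> x; rewrite in_itv/= => /andP[ax xb].
  by apply: is_derive_cw_g; lra.
- by apply: continuous_subspaceT => x; exact: continuous_cw_g.
by rewrite in_itv/=; exists c.
Qed.

Lemma cw_g1_MVT a b : -1 < a -> a < b -> b < 1 ->
  exists2 c, a < c < b & g1 b - g1 a = g2 c * (b - a).
Proof.
move=> a1 ab b1.
have d x : a <= x <= b -> is_derive x 1 g1 (g2 x).
  by move=> xab; apply: is_derive_cw_g1; lra.
have [||c] := @MVT R g1 g2 a b ab.
- by move=> x; rewrite in_itv/= => /andP[ax xb]; apply: d; rewrite !ltW.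
- apply: derivable_within_continuous => x; rewrite in_itv/= => xab.
  by have := d _ xab => dx; exact: ex_derive.
by rewrite in_itv/=; exists c.
Qed.

End Threshold.
End FreeEnergyMaximizer.

Lemma taylor2_at_critical {R : realType} (f f1 : R -> R) (m a : R) :
  (\near m, is_derive m (1 : R) f (f1 m)) -> is_derive m 1 f1 a ->
  f1 m = 0 -> forall e : R, 0 < e ->
  \forall x \near m, `|f x - f m - a / 2 * (x - m) ^+ 2| <= e * (x - m) ^+ 2.
Proof.
move=> df df1 f1m e e0.
have /is_derive1_caratheodory[k [f1E kc ka]] := df1.
have : \forall x \near m, `|a - k x| < e.
  by move/cvgrPdist_lt : kc => /(_ _ e0); rewrite ka.
move=> /(filterI df) /nbhs_ballP[d /= d0 H].
apply/nbhs_ballP; exists d => //= x xd.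
(* The mean value theorem, applied to [f] minus the expected quadratic term,
   produces a point [c] between [m] and [x]. *)
pose phi (z : R) := f z - a / 2 * (z - m) ^+ 2.
have dphi z : ball m d z -> is_derive z 1 phi ((k z - a) * (z - m)).
  move=> /H[dz _].
  have d2 : is_derive z 1 (fun u => (u - m) ^+ 2) (2 * (z - m)).
    have d1 : is_derive z 1 (fun u : R => u - m) 1.
      by apply: (@is_derive_eq _ _ _ (id - (cst m : R -> R))); rewrite subr0.
    rewrite (_ : (fun u => _) = (fun u : R => u - m) ^+ 2).
      by apply: is_derive_eq; rewrite /GRing.scale/= expr1 mulr1.
    by apply/funext => u; rewrite exprfctE.
  apply: (@is_derive_eq _ _ _ (f - ((a / 2) \*: (fun u => (u - m) ^+ 2)))).
  have -> : f1 z = k z * (z - m) by rewrite -f1E f1m subr0.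
  by rewrite /GRing.scale/=; field.
have bnd (c : R) : ball m d c -> `|c - m| <= `|x - m| ->
    `|(k c - a) * (c - m) * (x - m)| <= e * (x - m) ^+ 2.
  move=> /H[_ /ltW kc'] cx; rewrite -[(x - m) ^+ 2]ger0_norm ?sqr_ge0//.
  rewrite expr2 !normrM mulrA -mulrA -[leRHS]mulrA ler_pM//.
    by rewrite distrC.
  by rewrite ler_wpM2r.
have phim : phi m = f m by rewrite /phi subrr expr0n/= mulr0 subr0.
have -> : f x - f m - a / 2 * (x - m) ^+ 2 = phi x - phi m.
  by rewrite phim /phi; ring.
have near_ball (c : R) : `|c - m| <= `|x - m| -> ball m d c.
  move=> cx; rewrite /ball/= distrC; apply: le_lt_trans cx _.
  by move: xd; rewrite /ball/= distrC.
have cont (u v : R) : (forall c, u <= c <= v -> ball m d c) ->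
    {within `[u, v], continuous phi}.
  move=> h; apply: derivable_within_continuous => c; rewrite in_itv/= => /h.
  by move=> /dphi dc; exact: ex_derive.
have [xm|mx|->] := ltgtP x m; last by rewrite !subrr normr0 expr0n/= mulr0.
- have nb c : x <= c <= m -> `|c - m| <= `|x - m|.
    by move=> /andP[xc cm]; rewrite !ler0_norm; lra.
  have [||c] := @MVT R phi (fun z => (k z - a) * (z - m)) x m xm.
  + by move=> c; rewrite in_itv/= => /andP[xc cm]; apply/dphi/near_ball/nb; lra.
  + by apply: cont => c /nb /near_ball.
  + rewrite in_itv/= => cxm E.
    rewrite -[phi x - _]opprB E -mulrN opprB; apply: bnd.
      by apply/near_ball/nb; lra.
    by apply: nb; lra.
- have nb c : m <= c <= x -> `|c - m| <= `|x - m|.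
    by move=> /andP[xc cm]; rewrite !ger0_norm; lra.
  have [||c] := @MVT R phi (fun z => (k z - a) * (z - m)) m x mx.
  + by move=> c; rewrite in_itv/= => /andP[xc cm]; apply/dphi/near_ball/nb; lra.
  + by apply: cont => c /nb /near_ball.
  + rewrite in_itv/= => cxm E; rewrite E; apply: bnd.
      by apply/near_ball/nb; lra.
    by apply: nb; lra.
Qed.

Section Maximizer.
Context {R : realType} {p : nat} {beta : R}.
Hypotheses (hp : (2 <= p)%N) (hbeta : cw_threshold R p < beta).
Local Notation g := (cw_g p beta).
Local Notation g1 := (cw_g1 p beta).
Local Notation g2 := (cw_g2 p beta).
Implicit Types t x m : R.

Let beta_gt0 : 0 < beta. Proof. exact: (cw_threshold_gt hp hbeta).1. Qed.

Lemma cw_g1_0 : g1 0 = 0.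
Proof. by rewrite /cw_g1 atanh0 subr0 expr0n; case: p hp => [|[|n]]//; rewrite mulr0. Qed.

(** The slope of [g] tends to [-oo] at [1]: it is negative as soon as
    [- ln (1 - t) / 2] exceeds [p * beta]. *)
Lemma cw_g_one_not_max : exists2 t, 0 <= t < 1 & g 1 < g t.
Proof.
pose u : R := expR (- (2 * p%:R * beta)).
have u0 : 0 < u by exact: expR_gt0.
have pb : 0 < p%:R * beta by rewrite mulr_gt0// ltr0n; case: p hp.
have u1 : u < 1 by rewrite expR_lt1; lra.
exists (1 - u); first by lra.
have [|||c cab E] := @cw_g_MVT R p beta (1 - u) 1; [lra..|].
rewrite -subr_lt0 E nmulr_rlt0; first by lra.
rewrite /cw_g1 subr_lt0.
apply: (@le_lt_trans _ _ (p%:R * beta)).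
  rewrite -[leRHS]mulr1; apply: ler_wpM2l; first exact: ltW.
  by apply: exprn_ile1; lra.
have l1 : 0 < ln (1 + c) by apply: ln_gt0; lra.
have l2 : ln (1 - c) < ln u by rewrite ltr_ln ?posrE; lra.
by move: l2; rewrite expRK /atanh; lra.
Qed.

Lemma cw_maximizer_props m : pos_global_maximizer p beta m ->
  [/\ 0 < m < 1, 0 < g m & g1 m = 0].
Proof.
move=> [/andP[m0 m1] mx].
have m1' : m < 1.
  rewrite lt_neqAle m1 andbT; apply/eqP => mE.
  have [t t01] := cw_g_one_not_max; rewrite -mE ltNge mx//; lra.
split; first by rewrite m0.
  have [_ [t t01 gt]] := cw_threshold_gt hp hbeta.
  by apply: lt_le_trans gt (mx _ _); lra.
have dm : is_derive m 1 g (g1 m) by apply: is_derive_cw_g; lra.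
have [] : is_derive m 1 g 0.
  apply: (@derive1_at_max R g (-1) 1 m).
  - lra.
  - move=> t; rewrite in_itv/= => t1.
    by have d := is_derive_cw_g p beta t1; exact: ex_derive.
  - by rewrite in_itv/=; lra.
  - by move=> t; rewrite in_itv/= => t1; apply: mx; lra.
by move=> _ E; rewrite -(@derive_val _ _ _ _ _ _ _ dm).
Qed.

Lemma maximizer_itv m : pos_global_maximizer p beta m -> 0 < m < 1.
Proof. by move=> /cw_maximizer_props[]. Qed.

Lemma exists_maximizer : exists m, pos_global_maximizer p beta m.
Proof.
have [m] := @EVT_max R g 0 1 ler01 (continuous_subspaceT (@continuous_cw_g R p beta)).
rewrite in_itv/= => m01 mx.
have mx' t : 0 <= t <= 1 -> g t <= g m by move=> t01; apply: mx; rewrite in_itv.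
exists m; split.
  have [_ [t /mx' tm gt]] := cw_threshold_gt hp hbeta.
  rewrite lt_neqAle eq_sym (andP m01).1 (andP m01).2 !andbT.
  apply/eqP => mE; move: (lt_le_trans gt tm).
  by rewrite mE cw_g0// ltxx.
move=> t t1; apply: le_trans (cw_g_le_abs _ _ (ltW beta_gt0)) _.
by apply: mx'; rewrite normr_ge0/= ler_norml.
Qed.

(** The curvature [g2] is, up to the positive factor [1 - t ^+ 2], a constant
    times [t ^+ (p - 2) * (1 - t ^+ 2)] minus [1]. The derivative of this product
    has the sign of [p - 2 - p * t ^+ 2], which is decreasing in [t], so that the
    product cannot go down and then up again. *)
Lemma cw_g2_quasiconcave a b c : 0 < a -> a < b -> b < c -> c < 1 ->
  0 < g2 a -> g2 b < 0 -> g2 c < 0.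
Proof.
move=> a0 ab bc c1 ga gb; rewrite ltNge; apply/negP => gc.
pose K : R := p%:R * p.-1%:R * beta.
have K0 : 0 < K.
  by rewrite /K !mulr_gt0// ltr0n; case: p hp => [|[|n]].
pose u (t : R) := K * t ^+ p.-2 * (1 - t ^+ 2).
have uE t : 0 < t < 1 -> u t - 1 = g2 t * (1 - t ^+ 2).
  by move=> t01; rewrite /u /cw_g2 /K; field; apply/lt0r_neq0; nra.
have sq t : 0 < t < 1 -> 0 < 1 - t ^+ 2 by move=> t01; nra.
have ua : 1 < u a by rewrite -subr_gt0 uE ?pmulr_rgt0// ?sq//; lra.
have ub : u b < 1 by rewrite -subr_lt0 uE ?nmulr_rlt0// ?sq//; lra.
have uc : 1 <= u c by rewrite -subr_ge0 uE ?mulr_ge0// ?ltW ?sq//; lra.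
pose du (t : R) := K * p.-2%:R * t ^+ p.-2.-1 * (1 - t ^+ 2) +
                   K * t ^+ p.-2 * - (2 * t).
have dU t : is_derive t 1 u (du t).
  have d1 := is_derive_pow p.-2 K t.
  have d2 := is_derive_pow 2 (-1) t.
  have d3 : is_derive t 1 (fun x => 1 - x ^+ 2) (- (2 * t)).
    rewrite (_ : (fun x => _) = cst 1 + (fun x : R => -1 * x ^+ 2)).
      by apply: is_derive_eq; rewrite add0r expr1; ring.
    by apply/funext => x; rewrite !fctE/= mulN1r.
  apply: (@is_derive_eq _ _ _ ((fun x => K * x ^+ p.-2) * (fun x => 1 - x ^+ 2))).
  by rewrite /du /GRing.scale/=; ring.
have duE t : t * du t = K * t ^+ p.-2 * (p.-2%:R - (p.-2%:R + 2) * t ^+ 2).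
  rewrite /du; case: p.-2 => [|q]/=; last by rewrite [t ^+ q.+1]exprS; ring.
  by rewrite expr0; ring.
have mvt v w : v < w -> exists2 x, v < x < w & u w - u v = du x * (w - v).
  move=> vw; have [|x] := @MVT R u du v w vw (fun x _ => dU x).
    apply: derivable_within_continuous => x _.
    by have := dU x => d; exact: ex_derive.
  by rewrite in_itv/= => ? ?; exists x.
have [x xab Ex] := mvt _ _ ab.
have [y ybc Ey] := mvt _ _ bc.
have dx : du x < 0.
  have : du x * (b - a) < 0 by rewrite -Ex; lra.
  by rewrite pmulr_llt0//; lra.
have dy : 0 < du y.
  have : 0 < du y * (c - b) by rewrite -Ey; lra.
  by rewrite pmulr_lgt0//; lra.
have x0 : 0 < x by lra.
have y0 : 0 < y by lra.
have : x * du x < 0 by rewrite pmulr_rlt0.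
rewrite duE (pmulr_rlt0 _ (mulr_gt0 K0 (exprn_gt0 _ x0))) => hx.
have : 0 < y * du y by rewrite mulr_gt0.
rewrite duE (pmulr_rgt0 _ (mulr_gt0 K0 (exprn_gt0 _ y0))) => hy.
have q0 : 0 <= p.-2%:R :> R by [].
have xy : x ^+ 2 < y ^+ 2 by rewrite ltr_pXn2r// ?nnegrE; lra.
have : (p.-2%:R + 2) * x ^+ 2 < (p.-2%:R + 2) * y ^+ 2 by rewrite ltr_pM2l//; lra.
lra.
Qed.

(** As [g 0 = 0 < g m] and [g1] vanishes at [0] and at [m], the mean value
    theorem yields a point where [g2] is positive followed by one, before [m],
    where it is negative. *)
Lemma cw_g2_lt0_from m x : pos_global_maximizer p beta m ->
  m <= x < 1 -> g2 x < 0.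
Proof.
move=> /cw_maximizer_props[/andP[m0 m1] gm g1m] /andP[mx x1].
have [|||c /andP[c0 cm] E] := @cw_g_MVT R p beta 0 m; [lra..|].
have g1c : 0 < g1 c.
  have : 0 < g1 c * (m - 0) by rewrite -E (cw_g0 hp beta) subr0.
  by rewrite subr0 pmulr_lgt0.
have [|||a /andP[a0 ac] Ea] := @cw_g1_MVT R p beta 0 c; [lra..|].
have [|||b /andP[cb bm] Eb] := @cw_g1_MVT R p beta c m; [lra..|].
apply: (@cw_g2_quasiconcave a b); rewrite //; try lra.
  have : 0 < g2 a * (c - 0) by rewrite -Ea cw_g1_0 subr0.
  by rewrite subr0 pmulr_lgt0.
have : g2 b * (m - c) < 0 by rewrite -Eb g1m; lra.
by rewrite pmulr_llt0; lra.
Qed.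

Lemma maximizer_unique m m' :
  pos_global_maximizer p beta m -> pos_global_maximizer p beta m' -> m = m'.
Proof.
wlog mm' : m m' / m < m'.
  move=> H hm hm'; have [?|?|//] := ltgtP m m'; first exact: H.
  by apply/esym/H.
move=> hm hm'.
have [/andP[m0 m1] gm g1m] := cw_maximizer_props hm.
have [/andP[m'0 m'1] gm' g1m'] := cw_maximizer_props hm'.
have [|||c /andP[mc cm] E] := @cw_g1_MVT R p beta m m'; [lra..|].
have : g2 c < 0 by apply: (cw_g2_lt0_from hm); lra.
move: E; rewrite g1m g1m' subrr => /esym/eqP; rewrite mulf_eq0.
by case/orP => /eqP ?; lra.
Qed.

Lemma cw_g_taylor m : pos_global_maximizer p beta m ->
  forall e : R, 0 < e -> \forall x \near m,
    `|g x - g m - g2 m / 2 * (x - m) ^+ 2| <= e * (x - m) ^+ 2.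
Proof.
move=> /cw_maximizer_props[m01 gm g1m]; apply: taylor2_at_critical g1m.
  near=> x; apply: is_derive_cw_g; apply/andP; split; near: x.
    by apply: lt_nbhsr; lra.
  by apply: lt_nbhsl; lra.
by apply: is_derive_cw_g1; lra.
Unshelve. all: by end_near. Qed.

(** Near [m] the bound comes from the negative curvature; away from [m] it
    comes from the uniqueness of the maximizer and compactness. *)
Lemma cw_g_quadratic_bound m : pos_global_maximizer p beta m ->
  exists2 c, 0 < c & forall x, 0 <= x <= 1 -> g x <= g m - c * (x - m) ^+ 2.
Proof.
move=> hm; have [m01 gm _] := cw_maximizer_props hm.
have g2m : g2 m < 0 by apply: (cw_g2_lt0_from hm); lra.
have : 0 < - g2 m / 4 by lra.
move=> /(cw_g_taylor hm)/nbhs_ballP[d /= d0 H].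
have away a b : 0 <= a -> a <= b -> b <= 1 -> ~ (a <= m <= b) ->
    exists2 e, 0 < e & forall x, a <= x <= b -> g x <= g m - e.
  move=> a0 ab b1 mab.
  have [z] := @EVT_max R g a b ab (continuous_subspaceT (@continuous_cw_g R p beta)).
  rewrite in_itv/= => zab zmax; exists (g m - g z); last first.
    by move=> x xab; rewrite subKr; apply: zmax; rewrite in_itv.
  rewrite subr_gt0 lt_neqAle hm.2 ?andbT; last by lra.
  apply/eqP => zm; apply: mab.
  have z0 : 0 < z.
    rewrite lt_neqAle; apply/andP; split; last by lra.
    by apply/eqP => z0; move: gm; rewrite -zm -z0 cw_g0// ltxx.
  rewrite (@maximizer_unique m z)//; split; first by lra.
  by move=> t /hm.2; rewrite zm.
pose e := Num.min d (Num.min m (1 - m)).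
have e0 : 0 < e by rewrite /e !lt_min d0; lra.
have [em em1 ed] : [/\ e <= m, e <= 1 - m & e <= d].
  by rewrite /e; split; rewrite !ge_min ?lexx ?orbT.
have [||||c1 c10 h1] := away 0 (m - e); [lra..|].
have [||||c2 c20 h2] := away (m + e) 1; [lra..|].
exists (Num.min (- g2 m / 4) (Num.min c1 c2)).
  by rewrite !lt_min c10 c20; lra.
set c := Num.min _ _ => x x01.
have [cg cc1 cc2] : [/\ c <= - g2 m / 4, c <= c1 & c <= c2].
  by rewrite /c; split; rewrite !ge_min ?lexx ?orbT.
have sx : 0 <= (x - m) ^+ 2 <= 1.
  rewrite sqr_ge0/= -[leRHS](expr1n _ 2) -[leLHS]ger0_norm ?sqr_ge0// normrX.
  by rewrite lerXn2r ?nnegrE// ler_norml; lra.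
have scale k : 0 < k -> c <= k -> g x <= g m - k -> g x <= g m - c * (x - m) ^+ 2.
  move=> k0 ck gx; apply: le_trans gx _; rewrite lerD2l lerN2.
  apply: le_trans (_ : k * (x - m) ^+ 2 <= _); first by rewrite ler_wpM2r; lra.
  by rewrite ler_piMr; lra.
have [xl|xl] := leP x (m - e); first by apply: (scale c1) => //; apply: h1; lra.
have [xr|xr] := leP (m + e) x; first by apply: (scale c2) => //; apply: h2; lra.
have /H/= : ball m d x by rewrite /ball/= ltr_norml; lra.
rewrite ler_norml => /andP[_ h].
have : c * (x - m) ^+ 2 <= (- g2 m / 4) * (x - m) ^+ 2 by rewrite ler_wpM2r; lra.
lra.
Qed.

End Maximizer.

(** * Stirling's formula with an unspecified constant *)

Section Stirling.
Context {R : realType}.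

(** The logarithm of [n!] divided by [sqrt n * (n / e) ^ n]. Only the existence
    of its limit matters, since the limit cancels in ratios of weights. *)
Definition stirling_gap (n : nat) : R :=
  ln n`!%:R - (n%:R + 2^-1) * ln n%:R + n%:R.

Lemma atanh_bounds (z : R) : 0 < z < 1 -> z <= atanh z <= z / (1 - z ^+ 2).
Proof.
move=> /andP[z0 z1].
have [||c] := @MVT R atanh (fun t => (1 - t ^+ 2)^-1) 0 z z0.
- by move=> x; rewrite in_itv/= => x0z; apply: is_derive_atanh; lra.
- apply: derivable_within_continuous => x; rewrite in_itv/= => x0z.
  have d : is_derive x 1 atanh ((1 - x ^+ 2)^-1) by apply: is_derive_atanh; lra.
  exact: ex_derive.
rewrite in_itv/= atanh0 !subr0 => /andP[c0 cz] ->.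
have c2 : c ^+ 2 <= z ^+ 2 by rewrite lerXn2r ?nnegrE//; lra.
have z2 : z ^+ 2 < 1 by rewrite expr_lt1//; lra.
apply/andP; split.
  rewrite ler_peMl//; first lra.
  by rewrite invf_ge1; [have := sqr_ge0 c; lra|lra].
rewrite mulrC; apply: ler_wpM2l; first lra.
by rewrite lef_pV2 ?posrE; lra.
Qed.

(** With [z = (2n + 1)^-1] the decrement is [atanh z / z - 1], which lies
    between [0] and [z ^ 2 / (1 - z ^ 2) = (4 n (n + 1))^-1]. *)
Lemma stirling_gapS n : (0 < n)%N ->
  0 <= stirling_gap n - stirling_gap n.+1 <= (4 * n%:R)^-1 - (4 * n.+1%:R)^-1.
Proof.
move=> n0; pose x : R := n%:R; have x0 : 0 < x by rewrite ltr0n.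
have nS : n.+1%:R = x + 1 :> R by rewrite -natr1.
pose z : R := (2 * x + 1)^-1.
have z01 : 0 < z < 1.
  by rewrite invr_gt0 invf_lt1; lra.
have lnz : atanh z = 2^-1 * (ln (x + 1) - ln x).
  rewrite /atanh; congr (_ * _); rewrite -!ln_div ?posrE; [|lra..].
  congr ln; rewrite /z; field.
  by do ?(apply/andP; split); apply/lt0r_neq0; lra.
have -> : stirling_gap n - stirling_gap n.+1 = atanh z / z - 1.
  rewrite /stirling_gap factS natrM lnM ?posrE ?ltr0n ?fact_gt0// nS lnz /z.
  by rewrite invrK -/x; field.
have /andP[l u] := atanh_bounds z01.
rewrite subr_ge0 ler_pdivlMr ?mul1r ?l; last lra.
rewrite lerBlDr ler_pdivrMr; last lra.
apply: le_trans u _; rewrite nS -/x le_eqVlt; apply/orP; left; apply/eqP.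
rewrite /z; field.
by do !(apply/andP; split); apply/lt0r_neq0; nra.
Qed.

Lemma stirling_gap1 : stirling_gap 1 = 1.
Proof. by rewrite /stirling_gap (_ : 1`! = 1)%N// ln1 mulr0 subr0 add0r. Qed.

Lemma stirling_gap_bounds n : (0 < n)%N -> 3 / 4 <= stirling_gap n <= 1.
Proof.
case: n => // n _.
suff : 3 / 4 + (4 * n.+1%:R)^-1 <= stirling_gap n.+1 <= 1.
  move=> /andP[l ->]; rewrite andbT; apply: le_trans l.
  by rewrite lerDl invr_ge0 mulr_ge0.
elim: n => [|n /andP[l u]]; first by rewrite stirling_gap1; apply/andP; split; lra.
have := @stirling_gapS n.+1 isT; move: l.
move: (4 * n.+1%:R)^-1 (4 * n.+2%:R)^-1 => a b l /andP[l' u'].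
by apply/andP; split; lra.
Qed.

Lemma cvg_stirling_gap : exists l : R, stirling_gap n @[n --> \oo] --> l.
Proof.
have : cvgn (fun n => stirling_gap n.+1).
  apply: nonincreasing_is_cvgn.
    apply/nonincreasing_seqP => n.
    by have /andP[+ _] := @stirling_gapS n.+1 isT; rewrite subr_ge0.
  exists (3 / 4) => _ [n _ <-].
  by have /andP[] := @stirling_gap_bounds n.+1 isT.
move=> /cvg_ex[l hl]; exists l.
by rewrite -(cvg_shiftS stirling_gap).
Qed.

Lemma sqrt_nat N : (0 < N)%N -> Num.sqrt N%:R = expR (2^-1 * ln N%:R) :> R.
Proof.
move=> N0; apply/eqP; rewrite -(@eqrXn2 _ 2) ?sqrtr_ge0 ?expR_ge0//.
by rewrite sqr_sqrtr// -expRM_natl mulVKf// lnK ?posrE ?ltr0n.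
Qed.

(** The mean of [N] spins of which [j] are up. *)
Definition magnetization (N j : nat) : R := (2 * j%:R - N%:R) / N%:R.

Lemma binomial_stirling (N j : nat) : (0 < j < N)%N ->
  let x := magnetization N j in
  'C(N, j)%:R = 2 ^+ N * expR (- (N%:R * rate x)) * (2 / Num.sqrt N%:R) *
    expR (- (2^-1 * (ln (1 + x) + ln (1 - x))) +
          (stirling_gap N - stirling_gap j - stirling_gap (N - j))) :> R.
Proof.
move=> /andP[j0 jN] x; have N0 : (0 < N)%N by exact: ltn_trans jN.
have ln_fact n : ln n`!%:R = (n%:R + 2^-1) * ln n%:R - n%:R + stirling_gap n :> R.
  by rewrite /stirling_gap; ring.
pose n : R := N%:R; pose i : R := j%:R.
have n0 : 0 < n by rewrite ltr0n.
have i0 : 0 < i by rewrite ltr0n.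
have ni : i < n by rewrite ltr_nat.
have nk : (N - j)%:R = n - i by rewrite natrB// ltnW.
have xD : 1 + x = 2 * i / n by rewrite /x /magnetization -/n -/i; field; rewrite gt_eqF.
have xB : 1 - x = 2 * (n - i) / n.
  by rewrite /x /magnetization -/n -/i; field; rewrite gt_eqF.
have lD : ln (1 + x) = ln 2 + ln i - ln n.
  by rewrite xD ln_div ?posrE ?mulr_gt0// lnM ?posrE.
have lB : ln (1 - x) = ln 2 + ln (n - i) - ln n.
  by rewrite xB ln_div ?posrE ?mulr_gt0 ?subr_gt0// lnM ?posrE ?subr_gt0.
have xE : x = 2 * i / n - 1 by lra.
have C0 : 0 < 'C(N, j)%:R :> R by rewrite ltr0n bin_gt0 ltnW.
have two : expR (ln 2) = 2 :> R by rewrite lnK ?posrE.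
rewrite -[LHS]lnK ?posrE// (sqrt_nat N0) -/n -expRN.
rewrite -{1}two -{2}two -expRM_natl -!expRD; congr expR.
have /(congr1 (fun k : nat => ln (k%:R : R))) := @bin_fact N j (ltnW jN).
have f0 k : 0 < k`!%:R :> R by rewrite ltr0n fact_gt0.
rewrite natrM lnM ?posrE// ?ltr0n ?muln_gt0 ?fact_gt0//.
rewrite natrM lnM ?posrE// !ln_fact nk -/n -/i => E.
have -> : ln 'C(N, j)%:R = (n + 2^-1) * ln n - n + stirling_gap N -
  ((i + 2^-1) * ln i - i + stirling_gap j +
   ((n - i + 2^-1) * ln (n - i) - (n - i) + stirling_gap (N - j))) by lra.
by rewrite /rate lD lB xD xB; field; rewrite gt_eqF.
Qed.

End Stirling.

(** * Weights of the magnetization levels *)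

Lemma cvg_sqrt_nat {R : realType} :
  (Num.sqrt N%:R : R) @[N --> \oo] --> +oo.
Proof.
apply/cvgryPge => A; near=> N.
have [A0|A0] := leP A 0; first by rewrite (le_trans A0)// sqrtr_ge0.
rewrite -[A]gtr0_norm// -sqrtr_sqr ler_wsqrtr//.
by near: N; exact: nbhs_infty_ger.
Unshelve. all: by end_near. Qed.

Lemma cvg_invsqrt_nat {R : realType} :
  (Num.sqrt N%:R : R)^-1 @[N --> \oo] --> (0 : R).
Proof.
apply/(@gtr0_cvgV0 _ _ _ _ (fun N => Num.sqrt N%:R)); last exact: cvg_sqrt_nat.
by near=> N; rewrite sqrtr_gt0 ltr0n; near: N; exact: nbhs_infty_gt.
Unshelve. all: by end_near. Qed.

Lemma cvg_of_sqrt_scaled {R : realType} (x : nat -> R) (a y : R) :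
  Num.sqrt N%:R * (x N - a) @[N --> \oo] --> y -> x N @[N --> \oo] --> a.
Proof.
move=> hy.
have : (Num.sqrt N%:R)^-1 * (Num.sqrt N%:R * (x N - a)) @[N --> \oo] --> 0 * y.
  by apply: cvgM => //; exact: cvg_invsqrt_nat.
rewrite mul0r => h; apply/(@subr_cvg0 _ R^o); move: h; apply: cvg_trans.
apply: near_eq_cvg; near=> N; rewrite /= mulKf//= gt_eqF// sqrtr_gt0 ltr0n.
by near: N; exact: nbhs_infty_gt.
Unshelve. all: by end_near. Qed.

Section Weights.
Context {R : realType} {p : nat} {beta : R}.
Hypotheses (hp : (2 <= p)%N) (hbeta : cw_threshold R p < beta).
Variables (m : R) (hm : pos_global_maximizer p beta m).
Local Notation g := (cw_g p beta).
Local Notation g2 := (cw_g2 p beta).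
Local Notation mag := (magnetization (R := R)).

(** The total unnormalized Gibbs weight of the configurations with [j] spins
    up. *)
Definition cw_weight (N j : nat) : R :=
  'C(N, j)%:R * expR (beta * (N%:R * mag N j ^+ p)).

(** The exponential order of magnitude of the partition function. *)
Definition cw_scale (N : nat) : R := 2 ^+ N * expR (N%:R * g m).

Lemma cw_scale_gt0 N : 0 < cw_scale N.
Proof. by rewrite mulr_gt0 ?expR_gt0 ?exprn_gt0. Qed.

Lemma cw_weight_ge0 N j : 0 <= cw_weight N j.
Proof. by rewrite mulr_ge0 ?expR_ge0. Qed.

Lemma magnetizationD N j : (0 < N)%N -> 1 + mag N j = 2 * j%:R / N%:R.
Proof.
by move=> N0; rewrite /magnetization; field; rewrite gt_eqF ?ltr0n.
Qed.

Lemma magnetizationB N j : (0 < N)%N -> (j <= N)%N ->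
  1 - mag N j = 2 * (N - j)%:R / N%:R.
Proof.
move=> N0 jN; rewrite natrB// /magnetization; field.
by rewrite gt_eqF ?ltr0n.
Qed.

Lemma magnetization_itv N j : (0 < N)%N -> (j <= N)%N -> -1 <= mag N j <= 1.
Proof.
move=> N0 jN; have := magnetizationD j N0; have := magnetizationB N0 jN.
have : 0 <= 2 * j%:R / N%:R :> R by rewrite divr_ge0 ?mulr_ge0.
have : 0 <= 2 * (N - j)%:R / N%:R :> R by rewrite divr_ge0 ?mulr_ge0.
by move=> *; apply/andP; split; lra.
Qed.

Lemma cw_weightE N j : (0 < j < N)%N -> let x := mag N j in
  cw_weight N j / cw_scale N = 2 / Num.sqrt N%:R *
    expR (N%:R * (g x - g m) - 2^-1 * (ln (1 + x) + ln (1 - x)) +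
          (stirling_gap N - stirling_gap j - stirling_gap (N - j))).
Proof.
move=> jN x; apply/(canLR (mulfK (lt0r_neq0 (cw_scale_gt0 N)))).
rewrite /cw_weight /cw_scale binomial_stirling// -/x.
set s := 2 / _.
have -> : N%:R * (g x - g m) = - (N%:R * rate x) + beta * (N%:R * x ^+ p)
   - N%:R * g m by rewrite /cw_g; ring.
by rewrite !expRD !expRN; field; rewrite !expR_eq0.
Qed.

Lemma cw_weight_top N : (0 < N)%N ->
  cw_weight N N / cw_scale N = expR (N%:R * (g 1 - g m)).
Proof.
move=> N0; apply/(canLR (mulfK (lt0r_neq0 (cw_scale_gt0 N)))).
have xN : mag N N = 1 by rewrite /magnetization; field; rewrite gt_eqF ?ltr0n.
have two : expR (ln 2) = 2 :> R by rewrite lnK ?posrE.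
rewrite /cw_weight /cw_scale xN binn mul1r -{1}two -expRM_natl -!expRD.
by congr expR; rewrite /cw_g rate1 expr1n; ring.
Qed.

(** Only near [x = 1] is the factor [(1 - x ^ 2)^(-1/2)] unbounded, and it is
    at most [sqrt N] there; as [m < 1], half of the Gaussian decay absorbs it. *)
Lemma cw_weight_bound : exists c K : R, [/\ 0 < c, 0 < K &
  forall N j, (0 < N)%N -> (j <= N)%N -> 0 <= mag N j ->
    cw_weight N j / cw_scale N <=
      2 / Num.sqrt N%:R * (K * expR (- (c * (N%:R * (mag N j - m) ^+ 2))))].
Proof.
have m01 := maximizer_itv hp hbeta hm.
have [c c0 gle] := cw_g_quadratic_bound hp hbeta hm.
pose d : R := (1 - m) / 2.
have d0 : 0 < d by rewrite /d; lra.
pose k : R := `|- (2^-1 * ln d)| + `|- (2^-1 * ln (c * d ^+ 2))|.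
exists (c / 2), (expR k); split; [exact: divr_gt0|exact: expR_gt0|].
move=> N j N0 jN x0; set x := mag N j.
have n0 : 0 < N%:R :> R by rewrite ltr0n.
have x1 := magnetization_itv N0 jN; rewrite -/x in x1 x0.
have {}gle : N%:R * (g x - g m) <= - (c * (N%:R * (x - m) ^+ 2)).
  rewrite mulrCA -mulrN ler_pM2l//; have := gle x; rewrite x0; lra.
pose y : R := N%:R * (x - m) ^+ 2.
have y0 : 0 <= y by rewrite mulr_ge0 ?sqr_ge0// ltW.
have [kd kc] : - (2^-1 * ln d) <= k /\ - (2^-1 * ln (c * d ^+ 2)) <= k.
  rewrite /k; split; apply: le_trans (ler_norm _) _.
    by rewrite lerDl.
  by rewrite lerDr.
have far : d <= `|x - m| -> 2^-1 * ln N%:R - c * y <= k - c / 2 * y.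
  move=> dx; have d2 : d ^+ 2 <= (x - m) ^+ 2.
    by rewrite -[leRHS]real_normK ?num_real// lerXn2r ?nnegrE ?(ltW d0).
  have cd0 : 0 < c * d ^+ 2 by rewrite mulr_gt0 ?exprn_gt0.
  have : ln (c * d ^+ 2 * N%:R) < c * d ^+ 2 * N%:R.
    by apply: ln_sublinear; rewrite mulr_gt0.
  rewrite lnM ?posrE//.
  have : c * d ^+ 2 * N%:R <= c * y.
    by rewrite -mulrA ler_pM2l// /y mulrC ler_pM2l.
  lra.
have expD : 2 / Num.sqrt N%:R * (expR k * expR (- (c / 2 * y))) =
    2 / Num.sqrt N%:R * expR (k - c / 2 * y) by rewrite -expRD.
rewrite -/y expD; have [jN'|jN'] := ltnP j N; last first.
  have jE : j = N by apply/anti_leq; rewrite jN.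
  have xE : x = 1 by rewrite /x jE /magnetization; field; rewrite gt_eqF.
  have gle1 : N%:R * (g 1 - g m) <= - (c * y) by move: gle; rewrite {1}xE.
  have dx : d <= `|x - m| by rewrite xE ger0_norm /d; lra.
  rewrite jE cw_weight_top// sqrt_nat// -mulrA -expRN -expRD.
  apply: (@le_trans _ _ (expR (- (2^-1 * ln N%:R) + (k - c / 2 * y)))).
    by rewrite ler_expR; have := far dx; lra.
  by rewrite ler_peMl ?expR_ge0// ler1n.
have j0 : (0 < j)%N.
  case: j {jN jN'} @x x0 {y y0 far expD x1 gle} => // x.
  by rewrite /x /magnetization mulr0 sub0r mulNr divff ?gt_eqF//; lra.
rewrite cw_weightE ?j0// -/x; apply: ler_wpM2l.
  by rewrite divr_ge0 ?sqrtr_ge0.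
rewrite ler_expR.
have lD : 0 <= ln (1 + x) by apply: ln_ge0; lra.
have sN : stirling_gap N - stirling_gap j - stirling_gap (N - j) <= 0 :> R.
  have := @stirling_gap_bounds R N N0; have := @stirling_gap_bounds R j j0.
  have := @stirling_gap_bounds R (N - j); rewrite subn_gt0 => /(_ jN'); lra.
have [dx|xd] := leP d `|x - m|; last first.
  have : ln d <= ln (1 - x).
    rewrite ler_ln ?posrE//; move: xd; rewrite ltr_norml /d; lra.
  have := mulr_ge0 (ltW c0) y0; rewrite -/y in gle; lra.
have : ln N%:R^-1 <= ln (1 - x).
  have := magnetizationB N0 jN; rewrite -/x => ->.
  rewrite ler_ln ?posrE ?invr_gt0//; last first.
    by rewrite mulr_gt0 ?invr_gt0// mulr_gt0// ltr0n subn_gt0.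
  have k1 : 1 <= (N - j)%:R :> R by rewrite ler1n subn_gt0.
  by rewrite ler_peMl ?invr_ge0 ?(ltW n0)//; lra.
rewrite lnV ?posrE//; have := far dx; rewrite -/y in gle; lra.
Qed.

(** At distance [y / sqrt N] from [m] the second order expansion of [g] turns
    [exp (N * (g x - g m))] into a Gaussian factor, while the other factors of
    [cw_weightE] converge. *)
Lemma cw_weight_cvg : exists2 C : R, 0 < C &
  forall (j : nat -> nat) (y : R), (\forall N \near \oo, (j N <= N)%N) ->
  Num.sqrt N%:R * (mag N (j N) - m) @[N --> \oo] --> y ->
  cw_weight N (j N) / cw_scale N * (Num.sqrt N%:R / 2) @[N --> \oo]
    --> C * expR (g2 m / 2 * y ^+ 2).
Proof.
have m01 := maximizer_itv hp hbeta hm.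
have [L gapL] := @cvg_stirling_gap R.
exists (expR (- (2^-1 * (ln (1 + m) + ln (1 - m))) + (L - L - L))).
  exact: expR_gt0.
move=> j y jle hy; pose x N := mag N (j N).
have xm : x N @[N --> \oo] --> m := cvg_of_sqrt_scaled hy.
have nearx (a b : R) : a < m -> m < b -> \forall N \near \oo, a < x N < b.
  move=> am mb; near=> N; apply/andP; split; near: N.
    by apply: (cvgr_gt m).
  by apply: (cvgr_lt m).
have joo : j N @[N --> \oo] --> \oo.
  apply/(@cvgrnyP R); apply/cvgryPge => A; near=> N.
  have : 0 < x N < 1 by near: N; apply: nearx; lra.
  have N0 : (0 < N)%N by near: N; exact: nbhs_infty_gt.
  have := magnetizationD (j N) N0; rewrite -/(x N).
  have NA : A * 2 <= N%:R by near: N; exact: nbhs_infty_ger.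
  have n0 : 0 < N%:R :> R by rewrite ltr0n.
  move=> E xN; have : 1 * N%:R <= 2 * (j N)%:R :> R.
    by rewrite -ler_pdivlMr// -E; lra.
  lra.
have kjoo : (N - j N)%N @[N --> \oo] --> \oo.
  apply/(@cvgrnyP R); apply/cvgryPge => A; near=> N.
  have xN : 0 < x N < (1 + m) / 2 by near: N; apply: nearx; lra.
  have N0 : (0 < N)%N by near: N; exact: nbhs_infty_gt.
  have jN : (j N <= N)%N by near: N.
  have := magnetizationB N0 jN; rewrite -/(x N).
  have NA : A * 4 / (1 - m) <= N%:R by near: N; exact: nbhs_infty_ger.
  have n0 : 0 < N%:R :> R by rewrite ltr0n.
  move=> E; have : (1 - m) / 2 * N%:R <= 2 * (N - j N)%:R :> R.
    by rewrite -ler_pdivlMr// -E; lra.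
  by move: NA; rewrite ler_pdivrMr; lra.
have gap_cvg (k : nat -> nat) : k N @[N --> \oo] --> \oo ->
    (stirling_gap (k N) : R) @[N --> \oo] --> L.
  by move=> koo; exact: cvg_comp koo gapL.
have main : N%:R * (g (x N) - g m) @[N --> \oo] --> g2 m / 2 * y ^+ 2.
  pose u N := (Num.sqrt N%:R * (x N - m)) ^+ 2.
  have uy : u N @[N --> \oo] --> y ^+ 2.
    by rewrite expr2; under eq_fun do rewrite /u expr2; exact: cvgM.
  have uE N : u N = N%:R * (x N - m) ^+ 2 by rewrite /u exprMn sqr_sqrtr.
  apply: cvg_sub0 (cvgM (cvg_cst (g2 m / 2)) uy).
  apply/cvgr0Pnorm_le => e e0.
  pose M := y ^+ 2 + 1; have M0 : 0 < M by rewrite ltr_wpDl ?sqr_ge0.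
  have eM : 0 < e / M by rewrite divr_gt0.
  have tay := cw_g_taylor hp hbeta hm eM.
  near=> N.
  have : `|g (x N) - g m - g2 m / 2 * (x N - m) ^+ 2| <= e / M * (x N - m) ^+ 2.
    by near: N; exact: xm tay.
  move=> /(ler_wpM2l (ler0n R N)).
  rewrite -[X in X * `|_|]normr_nat -normrM => h.
  rewrite (_ : (_ - _) N = N%:R * (g (x N) - g m) - g2 m / 2 * u N)//.
  apply: le_trans (_ : e / M * u N <= _); last first.
    rewrite -[leRHS](@divfK _ M) ?gt_eqF// ler_wpM2l ?ltW//.
    near: N; apply: (cvgr_lt (y ^+ 2)) => //.
    by rewrite ltrDl.
  by move: h; rewrite uE; congr (`|_| <= _); ring.
apply: cvg_trans (_ : expR (N%:R * (g (x N) - g m)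
      + (- (2^-1 * (ln (1 + x N) + ln (1 - x N)))
      + (stirling_gap N - stirling_gap (j N) - stirling_gap (N - j N)))) @[N --> \oo]
    --> _); last first.
  rewrite mulrC -expRD; apply: continuous_cvg; first exact: continuous_expR.
  apply: cvgD main _; apply: cvgD.
    apply: cvgN; apply: cvgMl_tmp; apply: cvgD.
      apply: continuous_cvg; first by apply: continuous_ln; lra.
      by apply: cvgD => //; exact: cvg_cst.
    apply: continuous_cvg; first by apply: continuous_ln; lra.
    by apply: cvgB => //; exact: cvg_cst.
  apply: cvgB; last exact: gap_cvg.
  by apply: cvgB; [exact: gapL|exact: gap_cvg].
apply: near_eq_cvg; near=> N.
have N0 : (0 < N)%N by near: N; exact: nbhs_infty_gt.
have jN : (0 < j N < N)%N.
  apply/andP; split; first by near: N; exact: (joo _ (nbhs_infty_gt 0)).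
  by rewrite -subn_gt0; near: N; exact: (kjoo _ (nbhs_infty_gt 0)).
rewrite cw_weightE// -/(x N) addrA mulrAC mulrA divfK; last first.
  by rewrite gt_eqF// sqrtr_gt0 ltr0n.
by rewrite divff// mul1r.
Unshelve. all: by end_near. Qed.

End Weights.

(** * From lattice sums to integrals *)

Section LatticeSums.
Context {R : realType}.
Local Notation mu := (@lebesgue_measure R).

Lemma integrable_gauss (c : R) : 0 < c ->
  mu.-integrable setT (fun y => (expR (- (c * y ^+ 2)))%:E).
Proof.
move=> c0; pose s : R := Num.sqrt ((2 * c)^-1).
have s2 : s ^+ 2 = (2 * c)^-1 by rewrite sqr_sqrtr// invr_ge0; lra.
have s0 : s != 0 by rewrite gt_eqF// sqrtr_gt0 invr_gt0; lra.
have := @integrableZl _ _ R mu setT measurableT (normal_peak s)^-1 _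
  (integrable_normal_pdf 0 s).
apply: eq_integrable => //= y _; rewrite -EFinM normal_pdfE//; congr EFin.
rewrite mulKf ?gt_eqF ?normal_peak_gt0//; congr expR.
by rewrite subr0 -mulr_natr s2; field; rewrite gt_eqF.
Qed.

(** Masses [a N j], [j <= N], sit at the points [o N + j * D N] of lattices
    that become dense in the line. Spreading each mass uniformly over the cell
    to the right of its point turns the sum into the integral of a step
    function, and dominated convergence applies. *)
Lemma cvg_lattice_sum (a : nat -> nat -> R) (o D : nat -> R) (f : R -> R)
    (E : set R) (c K d : R) :
  let v N j := o N + j%:R * D N in
  0 < c -> 0 <= K -> (forall N, (0 < N)%N -> 0 < D N <= d) ->
  D N @[N --> \oo] --> (0 : R) ->
  o N @[N --> \oo] --> -oo -> v N N @[N --> \oo] --> +oo ->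
  (forall N j, 0 <= a N j) ->
  (forall N j, (0 < N)%N -> (j <= N)%N ->
    a N j <= D N * (K * expR (- (c * v N j ^+ 2)))) ->
  measurable_fun setT f -> mu.-negligible E ->
  (forall y, ~ E y -> forall j : nat -> nat, (\forall N \near \oo, (j N <= N)%N) ->
    v N (j N) @[N --> \oo] --> y -> a N (j N) / D N @[N --> \oo] --> f y) ->
  (\sum_(j < N.+1) a N j)%:E @[N --> \oo] --> (\int[mu]_y (f y)%:E)%E.
Proof.
move=> v c0 K0 hD D0 oNy vy a0 ale mf nE af.
pose I N j : set R := `[v N j, v N j + D N[%classic.
pose F N (y : R) : R := \sum_(j < N.+1) a N j / D N * \1_(I N j) y.
have cell N j y : I N j y -> v N j <= y < v N j + D N by rewrite /I/= in_itv.
have cell_uniq N i k y : (0 < N)%N -> I N i y -> I N k y -> i = k.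
  wlog ik : i k / (i <= k)%N.
    by move=> H N0 hi hk; case: (leqP i k) => [|/ltnW] ?; [|apply/esym]; exact: H.
  move=> /hD/andP[DN _] /cell/andP[_ h1] /cell/andP[h2 _].
  apply/anti_leq; rewrite ik/= leqNgt; apply/negP => lt.
  have : (i.+1%:R : R) <= k%:R by rewrite ler_nat.
  rewrite -natr1 -(ler_pM2r DN) mulrDl mul1r.
  by move: h1 h2; rewrite /v; lra.
have F_in N i y : (0 < N)%N -> (i <= N)%N -> I N i y -> F N y = a N i / D N.
  move=> N0 iN hi; rewrite /F (bigD1 (Ordinal (iN : (i < N.+1)%N)))//= big1.
    by rewrite addr0 indicE mem_set ?mulr1.
  move=> k ki; rewrite indicE memNset ?mulr0// => hk; move/eqP: ki; apply.
  by apply: val_inj; exact: cell_uniq hk hi.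
have F_out N y : (forall i, (i <= N)%N -> ~ I N i y) -> F N y = 0.
  move=> h; rewrite /F big1// => k _; rewrite indicE memNset ?mulr0//.
  by apply: h; rewrite -ltnS.
pose G (y : R) := K * expR (c * d ^+ 2) * expR (- (c / 2 * y ^+ 2)).
have F0 N y : (0 < N)%N -> 0 <= F N y.
  move=> N0; apply: sumr_ge0 => k _; rewrite mulr_ge0 ?divr_ge0//.
  by have /andP[/ltW] := hD N N0.
have FG N y : (0 < N)%N -> F N y <= G y.
  move=> N0; have /andP[DN Dd] := hD _ N0.
  have [[i [iN hi]]|none] := pselect (exists i, (i <= N)%N /\ I N i y); last first.
    rewrite F_out ?mulr_ge0 ?expR_ge0// => i iN hi.
    by apply: none; exists i.
  rewrite (F_in _ i)// ler_pdivrMr// mulrC; apply: le_trans (ale _ _ N0 iN) _.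
  rewrite ler_pM2l// /G -mulrA ler_wpM2l// -expRD ler_expR.
  have /andP[h1 h2] := cell _ _ _ hi; set w := v N i in h1 h2 *.
  have : (y - w) ^+ 2 <= d ^+ 2 by rewrite lerXn2r ?nnegrE; lra.
  have : 0 <= (y - 2 * w) ^+ 2 by exact: sqr_ge0.
  move=> h3 h4; have : c * (y ^+ 2 / 2) <= c * (d ^+ 2 + w ^+ 2).
    by rewrite ler_pM2l//; nra.
  lra.
have intF N : (0 < N)%N -> (\int[mu]_y (F N y)%:E = (\sum_(j < N.+1) a N j)%:E)%E.
  move=> N0; have /andP[DN Dd] := hD _ N0.
  under eq_integral do rewrite /F -sumEFin.
  rewrite ge0_integral_sum//=; last 2 first.
  - move=> k; apply/measurable_EFinP; apply: measurable_funM => //.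
    by apply: measurable_indic; exact: measurable_itv.
  - by move=> k y _; rewrite lee_fin mulr_ge0// divr_ge0// ltW.
  rewrite -sumEFin; apply: eq_bigr => k _.
  under eq_integral do rewrite EFinM.
  rewrite ge0_integralZl_EFin//=; last 2 first.
  - by apply/measurable_EFinP/measurable_indic; exact: measurable_itv.
  - by rewrite divr_ge0// ltW.
  rewrite integral_indic//=; last exact: measurable_itv.
  rewrite setIT lebesgue_measure_itv/= lte_fin ltrDl DN -EFinB -EFinM.
  by congr EFin; rewrite addrAC subrr add0r divfK// gt_eqF.
have mF N : measurable_fun setT (EFin \o F N).
  apply/measurable_EFinP; apply: measurable_sum => k; apply: measurable_funM => //.
  by apply: measurable_indic; exact: measurable_itv.
rewrite -(cvg_shiftS (fun N => (\sum_(j < N.+1) a N j)%:E)).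
have -> : (fun N => (\sum_(j < N.+2) a N.+1 j)%:E) =
    (fun N => \int[mu]_y (F N.+1 y)%:E)%E by apply/funext => N; rewrite intF.
have [|||||_ _] := @dominated_convergence _ _ R mu setT measurableT
  (fun N y => (F N.+1 y)%:E) (fun y => (f y)%:E) (fun y => (G y)%:E); last by [].
- by move=> N; exact: mF.
- exact/measurable_EFinP.
- apply: negligibleS nE => y; apply: contra_notP => nEy _.
  have h := af y nEy; apply/cvg_EFin; first exact: nearW.
  rewrite (cvg_shiftS (fun N => F N y)).
  pose j N := Num.truncn ((y - o N) / D N).
  have near_j : \forall N \near \oo, (0 < N)%N /\ (j N <= N)%N /\ I N (j N) y.
    near=> N; have N0 : (0 < N)%N by near: N; exact: nbhs_infty_gt.
    have /andP[DN Dd] := hD _ N0.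
    have oy : o N <= y by near: N; move/cvgrNyPle : oNy; exact.
    have yv : y < v N N by near: N; move/cvgryPgt : vy; exact.
    have q0 : 0 <= (y - o N) / D N by rewrite divr_ge0 ?subr_ge0// ltW.
    have /andP[l u] := truncn_itv q0.
    split => //; split.
      rewrite -ltnS -(ltr_nat R); apply: le_lt_trans l _.
      by rewrite ltr_pdivrMr// -natr1 mulrDl mul1r; move: yv; rewrite /v; lra.
    rewrite /I/= in_itv/= /v.
    move: l u; rewrite -/(j N); move: (j N) => k.
    rewrite ler_pdivlMr// ltr_pdivrMr// -natr1 mulrDl mul1r => l u.
    by apply/andP; split; lra.
  have : a N (j N) / D N @[N --> \oo] --> f y.
    apply: h; first by apply: filterS near_j => N [_ []].
    apply/cvgrPdist_le => e e0; near=> N.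
    have [N0 [jN /cell/andP[l u]]] : (0 < N)%N /\ (j N <= N)%N /\ I N (j N) y.
      by near: N.
    have De : `|0 - D N| <= e by near: N; move/cvgrPdist_le : D0; exact.
    have /andP[DN _] := hD _ N0.
    by move: De; rewrite sub0r normrN !ger0_norm ?(ltW DN)//; lra.
  apply: cvg_trans; apply: near_eq_cvg; apply: filterS near_j.
  by move=> N [N0 [jN hj]]; rewrite (F_in _ (j N)).
- have := @integrableZl _ _ R mu setT measurableT (K * expR (c * d ^+ 2)) _
    (@integrable_gauss (c / 2) (divr_gt0 c0 (ltr0n R 2))).
  by apply: eq_integrable.
- by apply: aeW => y N _ /=; rewrite lee_fin ger0_norm ?F0// FG.
Unshelve. all: by end_near. Qed.

End LatticeSums.

(** * The Curie-Weiss model in terms of the magnetization *)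

Section Combinatorics.
Context {R : realType}.

Definition ups (N : nat) (x : config N) : nat := #|[pred i | x i]|.

Lemma big_config (N : nat) (F : nat -> R) :
  \sum_(x : config N) F (ups x) = \sum_(j < N.+1) 'C(N, j)%:R * F j.
Proof.
pose up (A : {set 'I_N}) : config N := [ffun i => i \in A].
rewrite (reindex up)/=; last first.
  exists (fun x : config N => finset (fun i => x i)) => [A _|x _].
    by apply/setP => i; rewrite inE ffunE.
  by apply/ffunP => i; rewrite ffunE inE.
under eq_bigr => A _.
  rewrite (_ : ups (up A) = #|A|); last first.
    by rewrite /ups; apply: eq_card => i; rewrite inE ffunE.
  over.
have cardN (A : {set 'I_N}) : (#|A| < N.+1)%N.
  by rewrite ltnS -[X in (_ <= X)%N]card_ord max_card.
rewrite (partition_big (fun A : {set 'I_N} => Ordinal (cardN A)) xpredT)//=.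
apply: eq_bigr => j _.
rewrite (eq_bigr (fun=> F j)) => [|A /eqP <-//].
rewrite sumr_const mulr_natl; congr (_ *+ _).
have := @card_draws 'I_N j; rewrite card_ord => <-; apply: eq_card => A.
by rewrite !inE.
Qed.

Lemma sum_spin (N : nat) (x : config N) :
  \sum_(i < N) spin x i = 2 * (ups x)%:R - N%:R :> R.
Proof.
rewrite /ups -sum1_card natr_sum mulr_sumr.
have NE : N%:R = \sum_(i < N) (1 : R) by rewrite sumr_const card_ord.
rewrite NE [X in _ = X - _]big_mkcond -sumrB; apply: eq_bigr => i _.
by rewrite inE /spin; case: (x i); lra.
Qed.

Lemma big_tuple_cons (T : finType) (n : nat) (G : seq T -> R) :
  \sum_(s : n.+1.-tuple T) G s = \sum_i \sum_(s : n.-tuple T) G (i :: s).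
Proof.
rewrite pair_big/=.
rewrite (reindex (fun u : T * n.-tuple T => [tuple of u.1 :: u.2]))//=.
exists (fun s : n.+1.-tuple T => (thead s, [tuple of behead s])).
  move=> [i s] _ /=; congr pair; exact: val_inj.
by move=> s _; apply: val_inj => /=; case/tupleP: s => i s; rewrite theadE.
Qed.

Lemma big_tuple_prod (T : finType) (n : nat) (F : T -> R) :
  \sum_(s : n.-tuple T) \prod_(i <- s) F i = (\sum_i F i) ^+ n.
Proof.
elim: n => [|n IH].
  rewrite (eq_bigr (fun=> 1)) => [|s _]; last by rewrite tuple0 big_nil.
  by rewrite sumr_const card_tuple expn0.
rewrite (big_tuple_cons n (fun s => \prod_(i <- s) F i)) exprS mulr_suml.
apply: eq_bigr => i _; rewrite -IH mulr_sumr.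
by apply: eq_bigr => s _; rewrite big_cons.
Qed.

Section CurieWeiss.
Variables (p N : nat) (hp : (2 <= p)%N) (hN : (0 < N)%N).
Variable x : config N.
Local Notation J := (@cw_tensor R p N).
Local Notation xbar := (@magnetization R N (ups x)).

Let n0 : N%:R != 0 :> R. Proof. by rewrite pnatr_eq0 -lt0n. Qed.

Lemma cw_hamiltonian : hamiltonian J x = N%:R * xbar ^+ p.
Proof.
rewrite /hamiltonian /cw_tensor -mulr_sumr big_tuple_prod sum_spin.
rewrite /magnetization expr_div_n; case: p hp => // q _ /=.
by rewrite [N%:R ^+ q.+1]exprS; field; rewrite n0 expf_neq0.
Qed.

Lemma cw_local_field i : local_field J i x = xbar ^+ p.-1.
Proof.
rewrite /local_field /cw_tensor; case: p hp => // q _ /=.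
rewrite big_mkcond/= (big_tuple_cons q (fun s => if ohead s == Some i then
  (N%:R ^+ q)^-1 * \prod_(j <- behead s) spin x j else 0))/=.
rewrite (bigD1 i)//= [X in _ + X]big1 ?addr0 => [|k ki]; last first.
  by apply: big1 => s _; rewrite ifN//; apply: contra ki => /eqP[->].
rewrite eqxx -mulr_sumr big_tuple_prod sum_spin /magnetization expr_div_n.
by rewrite mulrC.
Qed.

End CurieWeiss.

(** Since every local field equals [xbar ^ (p - 1)], the estimating equation
    involves the configuration only through its magnetization. *)
Definition level_estimate (p : nat) (x : R) : \bar R :=
  ereal_inf [set b%:E | b in [set b : R | 0 <= b /\
    x ^+ p = x ^+ p.-1 * tanh (p%:R * b * x ^+ p.-1)]].

Lemma cw_mpl_estimate (p N : nat) (x : config N) : (2 <= p)%N -> (0 < N)%N ->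
  mpl_estimate (@cw_tensor R p N) x = level_estimate p (magnetization N (ups x)).
Proof.
move=> hp hN; congr ereal_inf; congr image; apply/seteqP.
have n0 : N%:R != 0 :> R by rewrite pnatr_eq0 -lt0n.
have E b : \sum_(i < N) local_field (@cw_tensor R p N) i x *
      tanh (p%:R * b * local_field (@cw_tensor R p N) i x) =
    N%:R * (magnetization N (ups x) ^+ p.-1 *
      tanh (p%:R * b * magnetization N (ups x) ^+ p.-1)).
  under eq_bigr do rewrite (cw_local_field hp).
  by rewrite sumr_const card_ord [RHS]mulr_natl.
split=> b /= [b0]; rewrite E cw_hamiltonian// => H; split => //.
  exact: mulfI H.
by rewrite H.
Qed.

Lemma tanhN (y : R) : tanh (- y) = - tanh y.
Proof. by rewrite /tanh opprK -mulNr opprB [expR y + _]addrC. Qed.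

(** Both sides of the estimating equation are even in [x]: its left-hand side
    is an even power, its right-hand side a product of two odd functions. *)
Lemma level_estimateN (p : nat) (x : R) : (0 < p)%N -> ~~ odd p ->
  level_estimate p (- x) = level_estimate p x.
Proof.
move=> p0 op; congr ereal_inf; congr image; apply/funext => b /=.
have op1 : odd p.-1 by rewrite -(prednK p0) /= negbK in op.
have -> : (- x) ^+ p = x ^+ p by rewrite exprNn -signr_odd (negbTE op) mul1r.
have -> : (- x) ^+ p.-1 = - x ^+ p.-1 by rewrite exprNn -signr_odd op1 mulN1r.
by rewrite mulrN tanhN mulrNN.
Qed.

Lemma tanh_expR2 (y : R) : tanh y = (expR (2 * y) - 1) / (expR (2 * y) + 1).
Proof.
have u0 : expR y != 0 by rewrite expR_eq0.
rewrite /tanh expRN -[LHS]mul1r -(divff u0) mulf_div mulrBr mulrDr divff//.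
by rewrite -expRD -mulr2n mulr_natl.
Qed.

Lemma tanhK (y : R) : atanh (tanh y) = y.
Proof.
rewrite tanh_expR2; set q := expR (2 * y); have q0 : 0 < q by exact: expR_gt0.
have q1 : q + 1 != 0 by rewrite gt_eqF//; lra.
have -> : atanh ((q - 1) / (q + 1)) = 2^-1 * ln q.
  rewrite /atanh -ln_div ?posrE.
  - by congr (_ * ln _); field; rewrite ?q1/=; apply/eqP; lra.
  - have -> : 1 + (q - 1) / (q + 1) = 2 * q / (q + 1) by field.
    by rewrite divr_gt0//; lra.
  - have -> : 1 - (q - 1) / (q + 1) = 2 / (q + 1) by field.
    by rewrite divr_gt0//; lra.
by rewrite expRK mulKf.
Qed.

Lemma atanhK (x : R) : -1 < x < 1 -> tanh (atanh x) = x.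
Proof.
move=> x1; rewrite tanh_expR2 /atanh mulVKf// expRB !lnK ?posrE; [|lra..].
have d : 1 - x != 0 by rewrite gt_eqF//; lra.
by field; rewrite d/=; apply/eqP; lra.
Qed.

(** The value [b] at which [x] solves the mean-field equation
    [x = tanh (p * b * x ^ (p - 1))]. *)
Definition field_inverse (p : nat) (x : R) : R := atanh x / (p%:R * x ^+ p.-1).

(** For [0 < x < 1] the estimating equation has exactly one solution. *)
Lemma level_estimateE (p : nat) (x : R) : (0 < p)%N -> 0 < x < 1 ->
  level_estimate p x = (field_inverse p x)%:E.
Proof.
move=> p0 /andP[x0 x1].
have xp : 0 < x ^+ p.-1 by rewrite exprn_gt0.
have pp : 0 < p%:R :> R by rewrite ltr0n.
rewrite /level_estimate (_ : [set b | _] = [set field_inverse p x]).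
  by rewrite image_set1 ereal_inf1.
have E : x ^+ p = x ^+ p.-1 * x by rewrite -exprSr prednK.
apply/seteqP; split=> [b /= [b0]|b /= ->].
  rewrite E => /(mulfI (lt0r_neq0 xp)) xE.
  by rewrite /field_inverse [in atanh _]xE tanhK; field; rewrite !lt0r_neq0.
split.
  rewrite divr_ge0 ?atanh_ge0 ?mulr_ge0 ?(ltW pp) ?(ltW xp)//.
  by rewrite (ltW x0).
rewrite E; congr (_ * _); rewrite /field_inverse.
rewrite (_ : _ * _ * _ = atanh x); last by field; rewrite !lt0r_neq0.
by rewrite atanhK//; lra.
Qed.

End Combinatorics.

(** * Fluctuations of the estimate around the maximizer *)

Lemma cvg_sqrt_natMr {R : realType} (k : R) : 0 < k ->
  Num.sqrt N%:R * k @[N --> \oo] --> +oo.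
Proof.
move=> k0; apply: (cvg_comp (fun N => Num.sqrt (N%:R : R)) (fun r => r * k)).
  exact: cvg_sqrt_nat.
by apply: gt0_cvgMly => //; exact: cvg_id.
Qed.

Lemma delta_method {R : realType} (h : R -> R) (m s y : R) (x r : nat -> R) :
  is_derive m 1 h s -> s != 0 -> x N @[N --> \oo] --> m ->
  r N * s * (x N - m) @[N --> \oo] --> y ->
  r N * (h (x N) - h m) @[N --> \oo] --> y.
Proof.
move=> /is_derive1_caratheodory[k [hE kc km]] s0 xm ry.
have kx : k (x N) @[N --> \oo] --> s.
  by rewrite -km; apply: continuous_cvg kc xm.
have : k (x N) / s * (r N * s * (x N - m)) @[N --> \oo] --> s / s * y.
  by apply: cvgM => //; apply: cvgM => //; exact: cvg_cst.
rewrite divff// mul1r.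
apply: cvg_trans; apply: near_eq_cvg; near=> N.
by rewrite hE; field.
Unshelve. all: by end_near. Qed.

Section Fluctuations.
Context {R : realType} {p : nat} {beta : R}.
Hypotheses (hp : (2 <= p)%N) (hbeta : cw_threshold R p < beta).
Variables (m : R) (hm : pos_global_maximizer p beta m).
Local Notation g := (cw_g p beta).
Local Notation g2 := (cw_g2 p beta).
Local Notation mag := (magnetization (R := R)).
Local Notation w := (@cw_weight R p beta).
Local Notation scale := (@cw_scale R p beta m).
Local Notation mu := (@lebesgue_measure R).

Definition slope : R := - g2 m / (p%:R * m ^+ p.-1).
Definition stddev : R := Num.sqrt (- g2 m / (p%:R ^+ 2 * m ^+ (2 * p - 2))).

Let p_gt0 : 0 < p%:R :> R. Proof. by rewrite ltr0n; case: p hp. Qed.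

Lemma curvature_lt0 : g2 m < 0.
Proof.
by apply: (cw_g2_lt0_from hp hbeta hm); have := maximizer_itv hp hbeta hm; lra.
Qed.

Lemma field_gt0 : 0 < p%:R * m ^+ p.-1.
Proof.
by have /andP[m0 _] := maximizer_itv hp hbeta hm; rewrite mulr_gt0// exprn_gt0.
Qed.

Lemma slope_gt0 : 0 < slope.
Proof. by rewrite divr_gt0 ?oppr_gt0 ?curvature_lt0 ?field_gt0. Qed.

Lemma atanh_maximizer : atanh m = p%:R * beta * m ^+ p.-1.
Proof.
have [_ _] := cw_maximizer_props hp hbeta hm.
by move=> /eqP; rewrite /cw_g1 subr_eq0 => /eqP.
Qed.

Lemma field_inverse_maximizer : field_inverse p m = beta.
Proof.
rewrite /field_inverse atanh_maximizer -[p%:R * beta * _]mulrA [p%:R * (_ * _)]mulrCA.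
by rewrite mulfK// gt_eqF// field_gt0.
Qed.

(** As [g1 t = p * t ^ (p - 1) * (beta - field_inverse p t)] and
    [field_inverse p m = beta], differentiating at [m] gives
    [g2 m = - p * m ^ (p - 1) * slope]. *)
Lemma is_derive_field_inverse : is_derive m 1 (field_inverse p) slope.
Proof.
have m01 := maximizer_itv hp hbeta hm.
have dA : is_derive m 1 atanh ((1 - m ^+ 2)^-1) by apply: is_derive_atanh; lra.
have dP := is_derive_pow p.-1 (p%:R : R) m.
have nz : p%:R * m ^+ p.-1 != 0 :> R by rewrite gt_eqF// field_gt0.
have dV := @is_deriveV _ (fun x : R => p%:R * x ^+ p.-1) m _ 1 nz dP.
have := is_deriveM dA dV; move=> /is_derive_eq; apply.
rewrite /GRing.scale/= atanh_maximizer /slope /cw_g2.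
have m0 : m != 0 by apply/eqP; lra.
have q0 : 1 - m ^+ 2 != 0 by rewrite gt_eqF//; nra.
have mp : m ^+ p.-1 != 0 by rewrite expf_neq0.
by field; rewrite (gt_eqF p_gt0) mp q0.
Qed.

(** The limit variance [(- g2 m)^-1] of the rescaled magnetization is multiplied
    by the square of the slope. *)
Lemma stddev_sqr : stddev ^+ 2 = slope ^+ 2 / - g2 m.
Proof.
have m01 := maximizer_itv hp hbeta hm; have g0 := curvature_lt0.
have E : (2 * p - 2 = p.-1 * 2)%N by case: p hp => // q _; rewrite /= mulnS addKn mulnC.
rewrite sqr_sqrtr; last first.
  rewrite divr_ge0 ?mulr_ge0 ?exprn_ge0// ?(ltW p_gt0)//; lra.
rewrite E exprM -exprMn /slope expr_div_n.
have f0 := field_gt0; set f := p%:R * _ in f0 *.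
by field; rewrite ?oppr_eq0 (gt_eqF f0) (lt_eqF g0).
Qed.

Lemma stddev_neq0 : stddev != 0.
Proof.
have : stddev ^+ 2 != 0; last by rewrite expf_eq0.
rewrite stddev_sqr gt_eqF// divr_gt0 ?exprn_gt0 ?slope_gt0//.
by rewrite oppr_gt0 curvature_lt0.
Qed.

(** The test [B] enters the dominated convergence argument as an indicator; it
    only has to converge along the lattice points that track a given [y],
    where it may be expressed through [field_inverse] by the delta method. *)
Lemma cvg_level_sum : exists2 k : R, 0 < k &
  forall (B : nat -> nat -> bool) (T E : set R), measurable T ->
  mu.-negligible E ->
  (forall y, ~ E y -> forall j : nat -> nat,
    mag N (j N) @[N --> \oo] --> m ->
    Num.sqrt N%:R * (field_inverse p (mag N (j N)) - beta) @[N --> \oo] --> y ->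
    \forall N \near \oo, B N (j N) = (y \in T)) ->
  \sum_(j < N.+1 | (0 < mag N j) && B N j) w N j / scale N @[N --> \oo]
    --> k * fine (normal_prob 0 stddev T).
Proof.
have m01 := maximizer_itv hp hbeta hm; have s0 := slope_gt0.
have [c [K [c0 K0 wle]]] := cw_weight_bound hp hbeta hm.
have [C C0 wcvg] := cw_weight_cvg hp hbeta hm.
have pk : 0 < normal_peak stddev by rewrite normal_peak_gt0// stddev_neq0.
pose k := C / slope / normal_peak stddev.
have k0 : 0 < k by apply: divr_gt0 => //; exact: divr_gt0.
exists k => // B T E mT nE BT.
pose a N j : R := if [&& (j <= N)%N, 0 < mag N j & B N j] then w N j / scale N else 0.
pose o N : R := Num.sqrt N%:R * (slope * (-1 - m)).
pose D N : R := 2 * slope * (Num.sqrt N%:R)^-1.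
pose f (y : R) : R := k * (normal_pdf 0 stddev y * \1_T y).
have sqrt0 N : (0 < N)%N -> 0 < Num.sqrt N%:R :> R.
  by move=> N0; rewrite sqrtr_gt0 ltr0n.
have vE N j : (0 < N)%N -> o N + j%:R * D N = Num.sqrt N%:R * slope * (mag N j - m).
  move=> N0; have r0 := sqrt0 N N0; rewrite /o /D /magnetization.
  have NE : N%:R = Num.sqrt N%:R ^+ 2 :> R by rewrite sqr_sqrtr.
  move: (Num.sqrt _) NE r0 => r NE r0; rewrite NE.
  by field; rewrite gt_eqF.
have fE y : f y = C / slope * expR (g2 m / 2 * (y / slope) ^+ 2) * \1_T y.
  rewrite /f normal_pdfE ?stddev_neq0// mulrA; congr (_ * _).
  rewrite /k mulrA divfK ?gt_eqF//; congr (_ * expR _).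
  rewrite subr0 stddev_sqr; have := curvature_lt0 => g0.
  by field; rewrite (gt_eqF s0) (lt_eqF g0).
have lim : (\sum_(j < N.+1) a N j)%:E @[N --> \oo] --> (\int[mu]_y (f y)%:E)%E.
  apply: (@cvg_lattice_sum R a o D f E (c / slope ^+ 2) (K / slope) (2 * slope)).
  - by rewrite divr_gt0// exprn_gt0.
  - by rewrite divr_ge0// ltW.
  - move=> N N0; rewrite /D divr_gt0 ?sqrt0//=; last exact: mulr_gt0.
    apply: ler_piMr; first by rewrite mulr_ge0// ltW.
    rewrite invf_le1 ?sqrt0//.
    by rewrite -[leLHS]sqrtr1 ler_wsqrtr// ler1n.
  - have : D N @[N --> \oo] --> 2 * slope * 0.
      by apply: cvgM; [exact: cvg_cst|exact: cvg_invsqrt_nat].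
    by rewrite mulr0.
  - have : Num.sqrt N%:R * (slope * (1 + m)) @[N --> \oo] --> +oo.
      by apply: cvg_sqrt_natMr; apply: mulr_gt0 => //; lra.
    move=> /cvgNrNy; apply: cvg_trans; apply: near_eq_cvg; near=> N.
    by rewrite /o opprfctE; ring.
  - have : Num.sqrt N%:R * (slope * (1 - m)) @[N --> \oo] --> +oo.
      by apply: cvg_sqrt_natMr; apply: mulr_gt0 => //; lra.
    apply: cvg_trans; apply: near_eq_cvg; near=> N.
    have N0 : (0 < N)%N by near: N; exact: nbhs_infty_gt.
    rewrite vE// (_ : mag N N = 1) ?mulrA//.
    by rewrite /magnetization; field; rewrite gt_eqF ?ltr0n.
  - move=> N j; rewrite /a; case: ifP => // _.
    by rewrite divr_ge0 ?cw_weight_ge0// ltW// cw_scale_gt0.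
  - move=> N j N0 jN; rewrite /a jN/= vE//.
    have rhs0 (u v : R) : 0 <= D N * (K / slope * expR v).
      apply: mulr_ge0; last by rewrite mulr_ge0 ?expR_ge0// divr_ge0// ltW.
      by rewrite /D divr_ge0 ?sqrtr_ge0// mulr_ge0// ltW.
    case: ifP => [/andP[x0 _]|_]; last exact: rhs0.
    apply: le_trans (wle _ _ N0 jN (ltW x0)) _.
    rewrite le_eqVlt; apply/orP; left; apply/eqP.
    have -> : c / slope ^+ 2 * (Num.sqrt N%:R * slope * (mag N j - m)) ^+ 2 =
        c * (N%:R * (mag N j - m) ^+ 2).
      rewrite [(Num.sqrt _ * _ * _) ^+ 2]exprMn [(Num.sqrt _ * _) ^+ 2]exprMn.
      by rewrite sqr_sqrtr//; field; rewrite (gt_eqF s0).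
    by rewrite /D; field; rewrite !gt_eqF// sqrt0.
  - apply: measurable_funM => //; apply: measurable_funM; last exact: measurable_indic.
    exact: measurable_normal_pdf.
  - exact: nE.
  - move=> y nEy j jN vy.
    have hy : Num.sqrt N%:R * slope * (mag N (j N) - m) @[N --> \oo] --> y.
      move: vy; apply: cvg_trans; apply: near_eq_cvg; near=> N.
      by rewrite vE//; near: N; exact: nbhs_infty_gt.
    have hy' : Num.sqrt N%:R * (mag N (j N) - m) @[N --> \oo] --> y / slope.
      have : Num.sqrt N%:R * slope * (mag N (j N) - m) / slope @[N --> \oo]
        --> y / slope by apply: cvgM => //; exact: cvg_cst.
      apply: cvg_trans; apply: near_eq_cvg; near=> N.
      by field; rewrite gt_eqF.
    have xm := cvg_of_sqrt_scaled hy'.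
    have delta := delta_method is_derive_field_inverse (lt0r_neq0 s0) xm hy.
    rewrite field_inverse_maximizer in delta.
    have BN := BT y nEy j xm delta.
    have wN : w N (j N) / scale N * (Num.sqrt N%:R / 2) / slope @[N --> \oo]
        --> C * expR (g2 m / 2 * (y / slope) ^+ 2) / slope.
      by apply: cvgM; [exact: wcvg|exact: cvg_cst].
    have x0 : \forall N \near \oo, 0 < mag N (j N) by apply: (cvgr_gt m) => //; lra.
    rewrite fE indicE; case: (boolP (y \in T)) => yT; last first.
      rewrite mulr0; have : (0 : R) @[N --> \oo] --> (0 : R) by exact: cvg_cst.
      apply: cvg_trans; apply: near_eq_cvg; near=> N.
      have BF : B N (j N) = (y \in T) by near: N.
      by rewrite /a BF (negbTE yT) !andbF mul0r.
    rewrite mulr1 mulrAC; move: wN; apply: cvg_trans; apply: near_eq_cvg; near=> N.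
    have BF : B N (j N) = (y \in T) by near: N.
    have xN : 0 < mag N (j N) by near: N.
    have jle : (j N <= N)%N by near: N.
    rewrite /a BF yT xN jle/= /D; field.
    by rewrite !gt_eqF ?sqrt0 ?cw_scale_gt0//; near: N; exact: nbhs_infty_gt.
have sumE N : \sum_(j < N.+1) a N j =
    \sum_(j < N.+1 | (0 < mag N j) && B N j) w N j / scale N.
  rewrite [RHS]big_mkcond; apply: eq_bigr => j _.
  by rewrite /a -ltnS ltn_ord.
have intf : (\int[mu]_y (f y)%:E = k%:E * normal_prob 0 stddev T)%E.
  rewrite /normal_prob [in RHS]integral_mkcond -ge0_integralZl_EFin//; last 3 first.
  - by move=> y _; rewrite patchE; case: ifP => // _; rewrite lee_fin normal_pdf_ge0.
  - apply/(measurable_restrictT _ _).1 => //; apply/measurable_EFinP.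
    by apply: measurable_funTS; exact: measurable_normal_pdf.
  - exact: ltW.
  apply: eq_integral => y _; rewrite /f EFinM patchE indicE.
  by case: ifP => _; rewrite ?mulr1 ?mulr0.
have fin : normal_prob 0 stddev T \is a fin_num by exact: fin_num_measure.
move: lim; rewrite intf -(fineK fin) -EFinM => /fine_cvg.
by under eq_fun do rewrite /= sumE.
Unshelve. all: by end_near. Qed.

End Fluctuations.

(** * Levels with negative magnetization *)

Section Folding.
Context {R : realType} {p : nat} {beta : R}.
Hypotheses (hp : (2 <= p)%N) (hbeta : cw_threshold R p < beta).
Local Notation mag := (magnetization (R := R)).
Local Notation w := (@cw_weight R p beta).
Implicit Types (N j : nat) (B : nat -> bool).

Lemma ising_prob_levels N B : (0 < N)%N ->
  ising_prob (@cw_tensor R p N) beta (fun x => B (ups x)) =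
  (\sum_(j < N.+1 | B j) w N j) / \sum_(j < N.+1) w N j.
Proof.
move=> N0.
have total (A : nat -> bool) :
    \sum_(x : config N | A (ups x)) expR (beta * hamiltonian (@cw_tensor R p N) x)
    = \sum_(j < N.+1 | A j) w N j.
  pose F j := if A j then expR (beta * (N%:R * mag N j ^+ p)) else 0.
  rewrite big_mkcond [RHS]big_mkcond/=.
  transitivity (\sum_(x : config N) F (ups x)).
    by apply: eq_bigr => x _; rewrite /F cw_hamiltonian.
  rewrite big_config; apply: eq_bigr => j _.
  by rewrite /F /cw_weight; case: (A j); rewrite ?mulr0.
rewrite /ising_prob /ising_pmf -mulr_sumr total /partition_fun.
rewrite mulVKf ?expf_neq0// (total xpredT) mulrC//.
Qed.

Lemma sum_binomial N : \sum_(j < N.+1) 'C(N, j)%:R = 2 ^+ N :> R.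
Proof.
under eq_bigr do rewrite -[_%:R]mulr1.
rewrite -(big_config N (fun=> 1)) sumr_const -natrX; congr (_%:R).
by rewrite card_ffun card_bool card_ord.
Qed.

Lemma magnetization_rev N j : (j <= N)%N -> mag N (N - j) = - mag N j.
Proof. by move=> jN; rewrite /magnetization natrB// -mulNr; congr (_ / _); ring. Qed.

(** The number of global maximizers of the free energy: [m], and [- m] when [p]
    is even. *)
Definition multiplicity : R := if odd p then 1 else 2.

Definition remainder N B : R := \sum_(j < N.+1 | B j) w N j -
  multiplicity * \sum_(j < N.+1 | (0 < mag N j) && B j) w N j.

(** For even [p] the levels of opposite magnetization have equal weights, so
    only the level [0] is left over; for odd [p] the levels of nonpositive
    magnetization have at most the weight they have at [beta = 0]. *)
Lemma remainder_bounds N B : (0 < N)%N ->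
  (~~ odd p -> forall j, (j <= N)%N -> B (N - j)%N = B j) ->
  0 <= remainder N B <= 2 ^+ N.
Proof.
move=> N0 Bsym.
have b0 : 0 < beta := (cw_threshold_gt hp hbeta).1.
have wC j : mag N j ^+ p <= 0 -> w N j <= 'C(N, j)%:R.
  move=> xp; rewrite /cw_weight ler_piMr// expR_le1.
  by rewrite pmulr_rle0// pmulr_rle0// ltr0n.
have part (A : pred nat) : (forall j, A j -> mag N j ^+ p <= 0) ->
    0 <= \sum_(j < N.+1 | A j) w N j <= 2 ^+ N.
  move=> Aneg; rewrite sumr_ge0/=; last by move=> j _; exact: cw_weight_ge0.
  rewrite -sum_binomial [leRHS](bigID (fun j : 'I__ => A j))/=.
  rewrite -[leLHS]addr0 lerD ?sumr_ge0// ler_sum// => j Aj.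
  exact/wC/Aneg.
have split1 : \sum_(j < N.+1 | B j) w N j =
    \sum_(j < N.+1 | (0 < mag N j) && B j) w N j +
    \sum_(j < N.+1 | ~~ (0 < mag N j) && B j) w N j.
  rewrite (bigID (fun j : 'I__ => 0 < mag N j))/=.
  by congr (_ + _); apply: eq_bigl => j; rewrite andbC.
rewrite /remainder /multiplicity; case: (boolP (odd p)) => op.
  rewrite mul1r split1 addrAC subrr add0r.
  apply: (part (fun j => ~~ (0 < mag N j) && B j)) => j /andP[+ _].
  by rewrite -leNgt => xj; rewrite exprn_odd_le0.
have split2 : \sum_(j < N.+1 | ~~ (0 < mag N j) && B j) w N j =
    \sum_(j < N.+1 | (mag N j < 0) && B j) w N j +
    \sum_(j < N.+1 | (mag N j == 0) && B j) w N j.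
  rewrite (bigID (fun j : 'I__ => mag N j < 0))/=.
  by congr (_ + _); apply: eq_bigl => j; case: (ltgtP (mag N j) 0) => _ //=;
    rewrite ?andbT ?andbF.
have mirror : \sum_(j < N.+1 | (mag N j < 0) && B j) w N j =
    \sum_(j < N.+1 | (0 < mag N j) && B j) w N j.
  rewrite (reindex_inj rev_ord_inj)/=; apply: eq_big => j.
    by rewrite subSS magnetization_rev -1?ltnS// oppr_lt0 Bsym -1?ltnS.
  move=> _; rewrite subSS /cw_weight bin_sub -1?ltnS// magnetization_rev -1?ltnS//.
  by rewrite exprNn -signr_odd (negbTE op) mul1r.
rewrite split1 split2 mirror.
set a := \sum_(_ < _ | _) _; rewrite (_ : _ - _ = \sum_(j < N.+1 |
  (mag N j == 0) && B j) w N j); last by ring.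
apply: (part (fun j => (mag N j == 0) && B j)) => j /andP[/eqP-> _].
by rewrite expr0n; case: p hp.
Qed.

Variables (m : R) (hm : pos_global_maximizer p beta m).
Local Notation scale := (@cw_scale R p beta m).

Lemma cvg_remainder (B : nat -> nat -> bool) :
  (~~ odd p -> forall N j, (0 < N)%N -> (j <= N)%N -> B N (N - j)%N = B N j) ->
  remainder N (B N) / scale N @[N --> \oo] --> 0.
Proof.
move=> Bsym; have [_ gm _] := cw_maximizer_props hp hbeta hm.
apply: (@squeeze_cvgr _ _ _ _ (fun=> 0) (fun N => expR (- (N%:R * cw_g p beta m)))).
- near=> N; have N0 : (0 < N)%N by near: N; exact: nbhs_infty_gt.
  have /andP[l u] := @remainder_bounds N (B N) N0 (fun op j => Bsym op N j N0).
  rewrite divr_ge0 ?(ltW (cw_scale_gt0 _ _))//= ler_pdivrMr ?cw_scale_gt0//.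
  by rewrite expRN /cw_scale mulrCA mulVf ?mulr1// expR_eq0.
- exact: cvg_cst.
- apply: (cvg_comp (fun N : nat => N%:R * cw_g p beta m) (fun x : R => expR (- x))).
    apply: (cvg_comp (fun N : nat => N%:R : R) (fun r => r * cw_g p beta m)).
      exact: cvgr_idn.
    by apply: gt0_cvgMly => //; exact: cvg_id.
  exact: cvgr_expR.
Unshelve. all: by end_near. Qed.

(** Numerator and denominator of the probability are, up to a remainder of
    smaller exponential order, the same multiple of sums over the levels of
    positive magnetization. *)
Lemma cvg_level_prob (B : nat -> nat -> bool) (T E : set R) : measurable T ->
  (@lebesgue_measure R).-negligible E ->
  (~~ odd p -> forall N j, (0 < N)%N -> (j <= N)%N -> B N (N - j)%N = B N j) ->
  (forall y, ~ E y -> forall j : nat -> nat,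
    mag N (j N) @[N --> \oo] --> m ->
    Num.sqrt N%:R * (field_inverse p (mag N (j N)) - beta) @[N --> \oo] --> y ->
    \forall N \near \oo, B N (j N) = (y \in T)) ->
  ising_prob (@cw_tensor R p N) beta (fun x => B N (ups x)) @[N --> \oo]
    --> fine (normal_prob 0 (@stddev R p beta m) T).
Proof.
move=> mT nE Bsym BT.
have [k k0 lim] := cvg_level_sum hp hbeta hm.
have limB := lim B T E mT nE BT.
have limT : \sum_(j < N.+1 | (0 < mag N j) && true) w N j / scale N @[N --> \oo]
    --> k * 1.
  have := lim (fun _ _ => true) setT set0 measurableT (negligible_set0 _).
  rewrite probability_setT/=; apply => y _ j _ _; apply: nearW => N.
  by rewrite in_setT.
have remB := cvg_remainder Bsym.
have remT : remainder N xpredT / scale N @[N --> \oo] --> 0.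
  by apply: (@cvg_remainder (fun _ _ => true)).
have mult0 : 0 < multiplicity by rewrite /multiplicity; case: ifP.
pose num (B : nat -> nat -> bool) N :=
  multiplicity * (\sum_(j < N.+1 | (0 < mag N j) && B N j) w N j / scale N) +
  remainder N (B N) / scale N.
have numE (A : nat -> nat -> bool) N :
    num A N = (\sum_(j < N.+1 | A N j) w N j) / scale N.
  by rewrite /num -mulr_suml /remainder; field; rewrite gt_eqF ?cw_scale_gt0.
have : num B N / num (fun _ _ => true) N @[N --> \oo] -->
    (multiplicity * (k * fine (normal_prob 0 (@stddev R p beta m) T)) + 0) /
    (multiplicity * (k * 1) + 0).
  apply: cvgM; first by apply: cvgD => //; apply: cvgM => //; exact: cvg_cst.
  apply: cvgV; first by rewrite addr0 mulr1 mulf_neq0// gt_eqF.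
  by apply: cvgD => //; apply: cvgM => //; exact: cvg_cst.
rewrite !addr0 mulr1 -mulf_div divff ?gt_eqF// mul1r mulrAC divff ?gt_eqF// mul1r.
apply: cvg_trans; apply: near_eq_cvg; near=> N.
have N0 : (0 < N)%N by near: N; exact: nbhs_infty_gt.
rewrite (ising_prob_levels (B N) N0) !numE.
by rewrite -mulf_div divff ?mulr1// invr_eq0 gt_eqF// cw_scale_gt0.
Unshelve. all: by end_near. Qed.

End Folding.

(** * The central limit theorem *)

Unset Implicit Arguments.

Theorem theorem2p14 (R : realType) (p : nat) (hp : (2 <= p)%N) (beta : R)
    (hbeta : cw_threshold R p < beta) :
  (exists! m : R, pos_global_maximizer p beta m) /\
  forall m : R, pos_global_maximizer p beta m ->
    cvg_in_distribution
      (fun N => ising_prob (@cw_tensor R p N) beta)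
      (fun N x => ((Num.sqrt (N%:R : R))%:E
                   * (mpl_estimate (@cw_tensor R p N) x - beta%:E))%E)
      (normal_prob 0
         (Num.sqrt (- derive1n 2 (cw_g p beta) m
                    / (p%:R ^+ 2 * m ^+ (2 * p - 2))))).
Proof.
split.
  have [m hm] := exists_maximizer hp hbeta.
  by exists m; split => // m' hm'; exact: (maximizer_unique hp hbeta).
move=> m hm t _; have m01 := maximizer_itv hp hbeta hm.
rewrite derive1n2_cw_g; last by lra.
rewrite -/(stddev m).
(* The event, as a test on the number [j] of spins up. *)
pose B N j : bool := ((Num.sqrt (N%:R : R))%:E *
  (level_estimate p (magnetization N j) - beta%:E) <= t%:E)%E.
have mT : measurable [set v : R | v <= t].
  by rewrite (_ : [set v | _] = `]-oo, t]%classic)//; apply/seteqP; split => v;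
    rewrite /= in_itv.
have fin : normal_prob 0 (@stddev R p beta m) [set v : R | v <= t] \is a fin_num.
  exact: fin_num_measure.
have : (ising_prob (@cw_tensor R p N) beta (fun x => B N (ups x)))%:E @[N --> \oo]
    --> normal_prob 0 (@stddev R p beta m) [set v : R | v <= t].
  rewrite -(fineK fin).
  apply/cvg_EFin; first exact: nearW.
  apply: (cvg_level_prob hp hbeta hm (E := [set t])) => //.
  - by apply/negligibleP => //; exact: lebesgue_measure_set1.
  - move=> op N j N0 jN; rewrite /B magnetization_rev// level_estimateN//.
    exact: ltnW.
  - move=> y yt j xm hy.
    have yt' : y != t by apply/eqP.
    have nearE : \forall N \near \oo, B N (j N) =
        (Num.sqrt N%:R * (field_inverse p (magnetization N (j N)) - beta) <= t).
      near=> N; have x01 : 0 < (magnetization N (j N) : R) < 1.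
        by apply/andP; split; near: N; [apply: (cvgr_gt m)|apply: (cvgr_lt m)] => //; lra.
      by rewrite /B level_estimateE ?(ltnW hp)// -EFinB -EFinM lee_fin.
    have [ylt|tly|yE] := ltgtP y t; last by rewrite yE eqxx in yt'.
      near=> N; rewrite (near nearE N)// mem_set/=; last exact: ltW.
      by apply: ltW; near: N; exact: (cvgr_lt y).
    near=> N; rewrite (near nearE N)// memNset/=; last by rewrite leNgt tly.
    by apply/negbTE; rewrite -ltNge; near: N; exact: (cvgr_gt y).
apply: cvg_trans; apply: near_eq_cvg; near=> N.
have N0 : (0 < N)%N by near: N; exact: nbhs_infty_gt.
congr EFin; apply: eq_bigl => x.
by rewrite /B cw_mpl_estimate.
Unshelve. all: by end_near. Qed.
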